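(* The compression semigroup $\Gamma$ of the dual Vinberg cone $\Omega$ has the Ol'shanskii polar decomposition $$\Gamma=G_0\exp(C),$$ and the interior $\Gamma^0$ of $\Gamma$ in $G$ is $\Gamma^0=G_0\exp(C^0)$.
   Context: Let $V$ be the space of real symmetric matrices $x=\begin{pmatrix} x_1 & 0 & x_4 \\ 0 & x_2 & x_5 \\ x_4 & x_5 & x_3 \end{pmatrix}$, let $V'=\{\mathrm{diag}(u_1,u_2,0): u_1,u_2\in\mathbb{R}\}\subset V$, and let $\Omega=\{x\in V: x \text{ positive definite}\}$ (the dual Vinberg cone), with closure $\overline{\Omega}$ in $V$. Let $T_\Omega=V+i\Omega\subset V_{\mathbb{C}}$, and let $G(T_\Omega)$ be the identity component of the group of holomorphic automorphisms of $T_\Omega$. Let $H'$ be the set of real matrices $\begin{pmatrix} a_1 & 0 & 0 \\ 0 & a_2 & 0 \\ a_4 & a_5 & a_3 \end{pmatrix}$ with $a_3>0$, let $H=\{A\in H': a_1a_2\neq0\}$ (a group), and let $W$ be the set of real matrices $\begin{pmatrix} x_1 & 0 & x_6 \\ 0 & x_2 & x_7 \\ x_4 & x_5 & x_3 \end{pmatrix}$. Let $\mathrm{Sp}(6,\mathbb{R})=\{g\in \mathrm{GL}(6,\mathbb{R}): gJg^T=J\}$ with $J=\begin{pmatrix} 0 & -I \\ I & 0 \end{pmatrix}$, and $$G=\left\{\begin{pmatrix} A & B \\ C & D \end{pmatrix}\in \mathrm{Sp}(6,\mathbb{R}) : A\in H',\ B\in W,\ C\in V',\ D^T\in H'\right\},$$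 a subgroup of $\mathrm{Sp}(6,\mathbb{R})$. The linear fractional action $g\cdot z=(Az+B)(Cz+D)^{-1}$ induces an isomorphism of $G$ onto $G(T_\Omega)$, by which the two groups are identified. For real points the action is given by the same formula wherever $Cx+D$ is invertible. Compression semigroup: $\Gamma=\{g\in G(T_\Omega): g\cdot\Omega\subset\Omega\}$, i.e. the $g\in G$ such that for every $x\in\Omega$ the matrix $Cx+D$ is invertible and $g\cdot x\in\Omega$. Let $G_0=\left\{\begin{pmatrix} A & 0 \\ 0 & (A^T)^{-1} \end{pmatrix}: A\in H\right\}\subset G$. Let $\mathfrak{g}_{1}=\left\{\begin{pmatrix} 0 & v \\ 0 & 0 \end{pmatrix}: v\in V\right\}$ and $\mathfrak{g}_{-1}=\left\{\begin{pmatrix} 0 & 0 \\ u & 0 \end{pmatrix}: u\in V'\right\}$ (subspaces of the Lie algebra of $G$). In the claim, $C$ denotes the closed convex cone $$C=\left\{\begin{pmatrix} 0 & v \\ u & 0 \end{pmatrix}: v\in\overline{\Omega},\ u\in\overline{\Omega}\cap V'\right\}\subset\mathfrak{g}_{-1}\oplus\mathfrak{g}_1,$$ $C^0$ denotes its interior in $\mathfrak{g}_{-1}\oplus\mathfrak{g}_1$ (i.e. the matrices with $v\in\Omega$ and $u=\mathrm{diag}(u_1,u_2,0)$, $u_1,u_2>0$), and $\exp$ is the matrix exponential. *)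

(* Defs.v *)
From HB Require Import structures.
From mathcomp Require Import all_boot all_order all_algebra.
From mathcomp Require Import all_classical all_reals all_analysis.

Set Implicit Arguments.
Unset Strict Implicit.
Unset Printing Implicit Defensive.

Import Order.TTheory GRing.Theory Num.Theory.
Import numFieldNormedType.Exports.

Local Open Scope classical_set_scope.
Local Open Scope ring_scope.

(* The interior of A `&` B in A, for the topology of A as a subspace of T. *)
Definition rel_interior (T : topologicalType) (A B : set T) : set T :=
  A `&` [set x | \forall y \near within A (nbhs x), B y].

Section DualVinbergCone.
Variable R : realType.

(* Matrix indices start at 0: the diagonal is x 0 0, x 1 1, x 2 2. *)

Definition posdefmx n (x : 'M[R]_n) : Prop :=
  x^T = x /\ forall u : 'cV[R]_n, u != 0 -> 0 < (u^T *m x *m u) 0 0.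

Definition V : set 'M[R]_3 := [set x | x^T = x /\ x 0 1 = 0].

Definition V' : set 'M[R]_3 := [set u | is_diag_mx u /\ u 2 2 = 0].

Definition Omega : set 'M[R]_3 := [set x | V x /\ posdefmx x].

Definition Omega_cl : set 'M[R]_3 := V `&` closure Omega.

Definition H' : set 'M[R]_3 :=
  [set a | [/\ a 0 1 = 0, a 0 2 = 0, a 1 0 = 0, a 1 2 = 0 & 0 < a 2 2]].

Definition H : set 'M[R]_3 := [set a | H' a /\ a 0 0 * a 1 1 != 0].

Definition W : set 'M[R]_3 := [set b | b 0 1 = 0 /\ b 1 0 = 0].

Definition J : 'M[R]_(3 + 3) := block_mx 0 (- 1%:M) 1%:M 0.

Definition Sp6 : set 'M[R]_(3 + 3) :=
  [set g | g \in unitmx /\ g *m J *m g^T = J].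

Definition G : set 'M[R]_(3 + 3) :=
  [set g | [/\ Sp6 g, H' (ulsubmx g), W (ursubmx g),
               V' (dlsubmx g) & H' (drsubmx g)^T]].

Definition denom (g : 'M[R]_(3 + 3)) (x : 'M[R]_3) : 'M[R]_3 :=
  dlsubmx g *m x + drsubmx g.

(* Meaningful only when [denom g x] is invertible. *)
Definition act (g : 'M[R]_(3 + 3)) (x : 'M[R]_3) : 'M[R]_3 :=
  (ulsubmx g *m x + ursubmx g) *m invmx (denom g x).

(* The identity component of the group of holomorphic automorphisms of the    *)
(* tube domain V + i Omega is identified with G through its action by linear  *)
(* fractional transformations.                                                *)
Definition Gamma : set 'M[R]_(3 + 3) :=
  [set g | G g /\
     forall x, Omega x -> denom g x \in unitmx /\ Omega (act g x)].

Definition G0 : set 'M[R]_(3 + 3) :=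
  [set block_mx A 0 0 (invmx A^T) | A in H].

Definition g_pos : set 'M[R]_(3 + 3) := [set block_mx 0 v 0 0 | v in V].

Definition g_neg : set 'M[R]_(3 + 3) := [set block_mx 0 0 u 0 | u in V'].

(* The subspace g_{-1} (+) g_1. *)
Definition g_odd : set 'M[R]_(3 + 3) :=
  [set X + Y | X in g_neg & Y in g_pos].

Definition C : set 'M[R]_(3 + 3) :=
  [set block_mx 0 v u 0 | v in Omega_cl & u in Omega_cl `&` V'].

Definition C_int : set 'M[R]_(3 + 3) := rel_interior g_odd C.

Definition expmx (X : 'M[R]_(3 + 3)) : 'M[R]_(3 + 3) :=
  limn (series (fun k : nat => (k`!%:R)^-1 *: X ^+ k)).

End DualVinbergCone.

(* Main.v *)
(* An element g of G is determined by two "strips", one for each of the first  *)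
(* two coordinates i, containing an element [a_i b_i; c_i d_i] of SL_2, plus    *)
(* the corner entries.  On a point x of Omega, g acts on x_i by the Moebius     *)
(* map of the i-th strip, and the last pivot x_3 - x_4^2/x_1 - x_5^2/x_2 of x   *)
(* becomes a_3^2 times itself, plus a_3 times the Schur complement              *)
(* b_3 - b_4 b_6/b_1 - b_5 b_7/b_2 of the block B, plus the squares             *)
(* a_3^2 (b_i x_{3+i} - x_i b_{5+i})^2 / (x_i b_i (a_i x_i + b_i)), which       *)
(* vanish simultaneously for a suitable x.  Hence g compresses Omega iff the    *)
(* entries of each SL_2 block have the same sign and that Schur complement is   *)
(* nonnegative.  The exponential of (v, u) in the cone C is explicit in terms   *)
(* of cosh and sinh of sqrt(u_i v_i), and multiplying it by G0 turns the Schur  *)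
(* complement of B into a positive multiple of that of v; solving for the       *)
(* factors gives the decomposition of Gamma.  The interior of Gamma is given by *)
(* the strict inequalities: these are open, and translating g by small          *)
(* unipotent elements of the SL_2's, or decreasing b_3, leaves Gamma as soon as *)
(* one of them is an equality.                                                  *)

Require Import Defs.
From HB Require Import structures.
From mathcomp Require Import all_boot all_order all_algebra.
From mathcomp Require Import all_classical all_reals all_analysis.
From mathcomp Require Import ring lra.

Set Implicit Arguments.
Unset Strict Implicit.
Unset Printing Implicit Defensive.

Import Order.TTheory GRing.Theory Num.Theory.
Import numFieldNormedType.Exports.

Local Open Scope classical_set_scope.
Local Open Scope ring_scope.

(** * Coordinates on G *)

Section ExplicitMatrices.
Variable R : realType.

(** The zero entry of [V] decouples the two strips, so the problem becomes two copies of the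
    semigroup of SL_2 preserving the half-line of positive reals, tied together by one scalar
    inequality on the corner entry. [Gamma_Gmx] turns compression of [Omega] into these sign
    conditions and this inequality.

    On the other side, [odd_mxX] and [expmx_odd] make the exponential explicit, and
    [polar_strip_pivot] shows that the Schur complement of the block B of a product in [G0] exp([C])
    is a positive multiple of the last pivot of v. Each strip can be solved for its polar factors
    ([polar_strip_exists]), after which v_3 is read off from b_3. This gives [polar_decomposition],
    and [polar_product] is the converse. Both lemmas also carry strict inequalities to strict
    inequalities, so that [rel_interior_Gamma] and [C_intP] settle the interiors. *)

Definition mx3 (a b c d e f g h k : R) : 'M[R]_3 :=
  \matrix_(i, j) nth 0 (nth [::] [:: [:: a; b; c]; [:: d; e; f]; [:: g; h; k]] i) j.

Lemma mx3_eta (A : 'M[R]_3) :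
  A = mx3 (A 0 0) (A 0 1) (A 0 2) (A 1 0) (A 1 1) (A 1 2) (A 2 0) (A 2 1) (A 2 2).
Proof.
apply/matrixP; case=> [[|[|[|//]]] ?] [[|[|[|//]]] ?]; rewrite mxE /=;
  by congr (A _ _); apply: val_inj.
Qed.

Lemma mx3_inj a b c d e f g h k a' b' c' d' e' f' g' h' k' :
  mx3 a b c d e f g h k = mx3 a' b' c' d' e' f' g' h' k' ->
  [/\ a = a', b = b' & c = c'] /\ [/\ d = d', e = e' & f = f']
  /\ [/\ g = g', h = h' & k = k'].
Proof.
move=> /matrixP E; split; last split; split;
  [ have := E 0 0 | have := E 0 1 | have := E 0 2
  | have := E 1 0 | have := E 1 1 | have := E 1 2
  | have := E 2 0 | have := E 2 1 | have := E 2 2 ]; by rewrite !mxE.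
Qed.

Lemma mx3M a b c d e f g h k a' b' c' d' e' f' g' h' k' :
  mx3 a b c d e f g h k *m mx3 a' b' c' d' e' f' g' h' k' =
  mx3 (a * a' + b * d' + c * g') (a * b' + b * e' + c * h') (a * c' + b * f' + c * k')
      (d * a' + e * d' + f * g') (d * b' + e * e' + f * h') (d * c' + e * f' + f * k')
      (g * a' + h * d' + k * g') (g * b' + h * e' + k * h') (g * c' + h * f' + k * k').
Proof.
apply/matrixP; case=> [[|[|[|//]]] ?] [[|[|[|//]]] ?];
  by rewrite !mxE !big_ord_recl big_ord0 !mxE /= addr0 addrA.
Qed.

Lemma mx3D a b c d e f g h k a' b' c' d' e' f' g' h' k' :
  mx3 a b c d e f g h k + mx3 a' b' c' d' e' f' g' h' k' =
  mx3 (a + a') (b + b') (c + c') (d + d') (e + e') (f + f') (g + g') (h + h') (k + k').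
Proof.
by apply/matrixP; case=> [[|[|[|//]]] ?] [[|[|[|//]]] ?]; rewrite !mxE.
Qed.

Lemma mx3N a b c d e f g h k :
  - mx3 a b c d e f g h k =
  mx3 (- a) (- b) (- c) (- d) (- e) (- f) (- g) (- h) (- k).
Proof.
by apply/matrixP; case=> [[|[|[|//]]] ?] [[|[|[|//]]] ?]; rewrite !mxE.
Qed.

Lemma mx3Z t a b c d e f g h k :
  t *: mx3 a b c d e f g h k =
  mx3 (t * a) (t * b) (t * c) (t * d) (t * e) (t * f) (t * g) (t * h) (t * k).
Proof.
by apply/matrixP; case=> [[|[|[|//]]] ?] [[|[|[|//]]] ?]; rewrite !mxE.
Qed.

Lemma mx3T a b c d e f g h k :
  (mx3 a b c d e f g h k)^T = mx3 a d g b e h c f k.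
Proof.
by apply/matrixP; case=> [[|[|[|//]]] ?] [[|[|[|//]]] ?]; rewrite !mxE.
Qed.

Lemma mx3_scalar a : a%:M = mx3 a 0 0 0 a 0 0 0 a.
Proof.
by apply/matrixP; case=> [[|[|[|//]]] ?] [[|[|[|//]]] ?]; rewrite !mxE.
Qed.

Lemma mx3_0 : 0 = mx3 0 0 0 0 0 0 0 0 0.
Proof.
by apply/matrixP; case=> [[|[|[|//]]] ?] [[|[|[|//]]] ?]; rewrite !mxE.
Qed.

Lemma mx3_upper_unit a c e f k :
  (mx3 a 0 c 0 e f 0 0 k \in unitmx) = [&& a != 0, e != 0 & k != 0].
Proof.
rewrite unitmxE -det_tr det_trig; last first.
  apply/is_trig_mxP; case=> [[|[|[|//]]] ?] [[|[|[|//]]] ?] //; by rewrite !mxE.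
by rewrite !big_ord_recl big_ord0 !mxE /= mulr1 unitfE !mulf_eq0 !negb_or.
Qed.

(* A strip holds the entries of an element of G that are indexed by one of the *)
(* first two coordinates i: in the notation of the context                     *)
(*   a_i, b_i, c_i, d_i, a_{3+i}, b_{3+i}, b_{5+i}, d_{3+i}.                   *)
Record strip := Strip {
  sa : R; sb : R; sc : R; sd : R; sar : R; sbr : R; sbc : R; sdc : R }.

(** These are the nontrivial entries of g J g^T = J that involve the strip: the determinant of the
    SL_2 block, then entry (2,0) of B C^T - A D^T and entry (0,2) of B A^T - A B^T, written here for
    the first strip. *)
Definition strip_rel (a3 : R) (s : strip) : Prop :=
  [/\ sa s * sd s - sb s * sc s = 1,
      sar s * sd s + a3 * sdc s = sbr s * sc s &
      sa s * sbr s = sar s * sb s + a3 * sbc s].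

Definition Gmx (s t : strip) (a3 b3 d3 : R) : 'M[R]_(3 + 3) :=
  block_mx (mx3 (sa s) 0 0 0 (sa t) 0 (sar s) (sar t) a3)
           (mx3 (sb s) 0 (sbc s) 0 (sb t) (sbc t) (sbr s) (sbr t) b3)
           (mx3 (sc s) 0 0 0 (sc t) 0 0 0 0)
           (mx3 (sd s) 0 (sdc s) 0 (sd t) (sdc t) 0 0 d3).

Lemma symplectic_block (A B U D : 'M[R]_3) :
  block_mx A B U D *m J R *m (block_mx A B U D)^T =
  block_mx (B *m A^T - A *m B^T) (B *m U^T - A *m D^T)
           (D *m A^T - U *m B^T) (D *m U^T - U *m D^T).
Proof.
rewrite /J tr_block_mx !mulmx_block !mulmx0 !mulmx1 !mulmxN !mulmx1 !add0r !addr0.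
by rewrite !mulNmx.
Qed.

(** The inverse of J is - J, so the relation itself exhibits a right inverse of g. *)
Lemma Sp6P (g : 'M[R]_(3 + 3)) : Sp6 g <-> g *m J R *m g^T = J R.
Proof.
split=> [[]//|E]; split=> //.
have JJ : J R *m (- J R) = 1%:M.
  rewrite /J mulmxN mulmx_block !mulmx0 !mul0mx !mulmx1 !mul1mx !add0r !addr0.
  by rewrite opp_block_mx !oppr0 !opprK scalar_mx_block.
have : g *m (J R *m g^T *m (- J R)) = 1%:M by rewrite !mulmxA E.
by case/mulmx1_unit.
Qed.

Lemma G_Gmx s t (a3 b3 d3 : R) : 0 < a3 -> a3 * d3 = 1 ->
  strip_rel a3 s -> strip_rel a3 t -> G (Gmx s t a3 b3 d3).
Proof.
move=> a30 ad3 [s1 s2 s3] [t1 t2 t3].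
have d30 : 0 < d3 by rewrite -(pmulr_rgt0 _ a30) ad3.
rewrite /Gmx; split; rewrite ?block_mxKul ?block_mxKur ?block_mxKdl ?block_mxKdr.
- apply/Sp6P; rewrite symplectic_block /J !mx3T !mx3M !mx3N !mx3D !mx3_scalar mx3N.
  rewrite mx3_0; congr block_mx; congr mx3; rewrite ?(mulr0, mul0r, addr0, add0r);
    lra.
- by split; rewrite !mxE /=.
- by split; rewrite !mxE /=.
- split; last by rewrite mxE.
  by apply/is_diag_mxP; case=> [[|[|[|//]]] ?] [[|[|[|//]]] ?] //; rewrite mxE.
- by rewrite mx3T; split; rewrite !mxE /=.
Qed.

Lemma GP (g : 'M[R]_(3 + 3)) : G g ->
  exists s t a3 b3 d3, [/\ g = Gmx s t a3 b3 d3, 0 < a3, a3 * d3 = 1,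
    strip_rel a3 s & strip_rel a3 t].
Proof.
rewrite -(submxK g).
move: (ulsubmx g) (ursubmx g) (dlsubmx g) (drsubmx g) => A B U D; case; rewrite ?block_mxKul ?block_mxKur ?block_mxKdl ?block_mxKdr.
move=> /Sp6P E [A1 A2 A3 A4 A5] [B1 B2] [/is_diag_mxP U1 U2].
rewrite /H' /= !mxE => -[D1 D2 D3 D4 D5].
exists (Strip (A 0 0) (B 0 0) (U 0 0) (D 0 0) (A 2 0) (B 2 0) (B 0 2) (D 0 2)).
exists (Strip (A 1 1) (B 1 1) (U 1 1) (D 1 1) (A 2 1) (B 2 1) (B 1 2) (D 1 2)).
exists (A 2 2), (B 2 2), (D 2 2).
have EA : A = mx3 (A 0 0) 0 0 0 (A 1 1) 0 (A 2 0) (A 2 1) (A 2 2).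
  by rewrite [LHS]mx3_eta A1 A2 A3 A4.
have EB : B = mx3 (B 0 0) 0 (B 0 2) 0 (B 1 1) (B 1 2) (B 2 0) (B 2 1) (B 2 2).
  by rewrite [LHS]mx3_eta B1 B2.
have EU : U = mx3 (U 0 0) 0 0 0 (U 1 1) 0 0 0 0.
  by rewrite [LHS]mx3_eta U2 (U1 0 1) ?(U1 0 2) ?(U1 1 0) ?(U1 1 2) ?(U1 2 0) ?(U1 2 1).
have ED : D = mx3 (D 0 0) 0 (D 0 2) 0 (D 1 1) (D 1 2) 0 0 (D 2 2).
  by rewrite [LHS]mx3_eta D1 D2 D3 D4.
move: E; rewrite symplectic_block EA EB EU ED.
rewrite !mx3T !mx3M !mx3N !mx3D /J !mx3_scalar mx3N mx3_0 => /eq_block_mx[+ + _ _].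
move=> /mx3_inj[[_ _ e1] [[_ _ e2] _]].
move=> /mx3_inj[[e3 _ _] [[_ e4 _] [e5 e6 e7]]].
move: e1 e2 e3 e4 e5 e6 e7; rewrite ?(mulr0, mul0r, addr0, add0r) !mxE /= => e1 e2 e3 e4 e5 e6 e7.
split; rewrite ?mxE //=; [lra | split => /=; lra | split => /=; lra].
Qed.

End ExplicitMatrices.

(** * Coordinates on the cone *)

Section Cone.
Variable R : realType.
Implicit Types (s t : strip R).

Definition symx (x1 x2 x3 x4 x5 : R) : 'M[R]_3 := mx3 x1 0 x4 0 x2 x5 x4 x5 x3.

Lemma V_symx x1 x2 x3 x4 x5 : V (symx x1 x2 x3 x4 x5).
Proof. by split; [rewrite /symx mx3T | rewrite mxE]. Qed.

Lemma VE (x : 'M[R]_3) : V x -> x = symx (x 0 0) (x 1 1) (x 2 2) (x 2 0) (x 2 1).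
Proof.
move=> [sx x01]; have e i j : x i j = x j i by rewrite -[in LHS]sx mxE.
by rewrite /symx [LHS]mx3_eta x01 (e 1 0) x01 (e 0 2) (e 1 2).
Qed.

(** Each term is an entry of x times a constant, so continuity in x is immediate; it agrees with u^T
    x u on [V]. *)
Definition qform (u0 u1 u2 : R) (x : 'M[R]_3) : R :=
  x 0 0 * u0 ^+ 2 + x 1 1 * u1 ^+ 2 + x 2 2 * u2 ^+ 2
  + x 2 0 * (2 * (u0 * u2)) + x 2 1 * (2 * (u1 * u2)).

Lemma qform_symx u0 u1 u2 x1 x2 x3 x4 x5 :
  qform u0 u1 u2 (symx x1 x2 x3 x4 x5) = x1 * u0 ^+ 2 + x2 * u1 ^+ 2
    + x3 * u2 ^+ 2 + 2 * x4 * (u0 * u2) + 2 * x5 * (u1 * u2).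
Proof. by rewrite /qform !mxE /=; ring. Qed.

Lemma qformE (u : 'cV[R]_3) x : V x ->
  (u^T *m x *m u) 0 0 = qform (u 0 0) (u 1 0) (u 2 0) x.
Proof.
move=> /VE ->; rewrite qform_symx !(mxE, big_ord_recl, big_ord0) /=.
have -> : lift ord0 (ord0 : 'I_2) = 1 :> 'I_3 by apply: val_inj.
have -> : lift ord0 (lift ord0 (ord0 : 'I_1)) = 2 :> 'I_3 by apply: val_inj.
have -> : (ord0 : 'I_3) = 0 by apply: val_inj.
ring.
Qed.

Lemma OmegaE x : V x ->
  Omega x <-> forall u0 u1 u2, [|| u0 != 0, u1 != 0 | u2 != 0] ->
                               0 < qform u0 u1 u2 x.
Proof.
move=> Vx; split=> [[_ [_ H]] u0 u1 u2 u|H].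
  have := H (\col_i nth 0 [:: u0; u1; u2] i).
  rewrite qformE // !mxE /=; apply; apply: contraL u => /eqP/colP E.
  have := E 0; have := E 1; have := E 2; rewrite !mxE /= => -> -> ->.
  by rewrite eqxx.
split=> //; split; first by case: Vx.
move=> u u0; rewrite qformE //; apply: H; apply: contraR u0.
rewrite !negb_or !negbK => /and3P[/eqP e0 /eqP e1 /eqP e2].
apply/eqP/colP; case=> [[|[|[|//]]] ?]; rewrite mxE;
  [rewrite -[RHS]e0 | rewrite -[RHS]e1 | rewrite -[RHS]e2];
  by congr (u _ _); apply: val_inj.
Qed.

Lemma qform_squares u0 u1 u2 x1 x2 x3 x4 x5 : 0 < x1 -> 0 < x2 ->
  qform u0 u1 u2 (symx x1 x2 x3 x4 x5) =
  x1 * (u0 + x4 / x1 * u2) ^+ 2 + x2 * (u1 + x5 / x2 * u2) ^+ 2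
  + (x3 - x4 ^+ 2 / x1 - x5 ^+ 2 / x2) * u2 ^+ 2.
Proof. by move=> x10 x20; rewrite qform_symx; field; rewrite !gt_eqF. Qed.

Lemma Omega_symx x1 x2 x3 x4 x5 : Omega (symx x1 x2 x3 x4 x5) <->
  [/\ 0 < x1, 0 < x2 & x4 ^+ 2 / x1 + x5 ^+ 2 / x2 < x3].
Proof.
rewrite OmegaE; last exact: V_symx; split=> [H|[x10 x20 x30] u0 u1 u2 u].
  have x10 : 0 < x1 by have := H 1 0 0; rewrite qform_symx oner_neq0 => /(_ isT); lra.
  have x20 : 0 < x2.
    by have := H 0 1 0; rewrite qform_symx oner_neq0 orbT => /(_ isT); lra.
  (* This vector annihilates the first two squares and leaves the last pivot. *)
  split=> //; have := H (- (x4 / x1)) (- (x5 / x2)) 1.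
  rewrite oner_neq0 !orbT qform_squares // => /(_ isT); lra.
have sq (x y : R) : 0 < x -> 0 <= x * y ^+ 2.
  by move=> x0; apply: mulr_ge0; [exact: ltW | exact: sqr_ge0].
have sqn (x y : R) : 0 < x -> y != 0 -> 0 < x * y ^+ 2.
  by move=> x0 yn; rewrite mulr_gt0 // exprn_even_gt0.
rewrite qform_squares //; set p := u0 + _; set q := u1 + _.
have p0 := sq _ p x10; have q0 := sq _ q x20.
have x30' : 0 < x3 - x4 ^+ 2 / x1 - x5 ^+ 2 / x2 by lra.
have r0 := sq _ u2 x30'.
have [u20|u20] := eqVneq u2 0; last by have := sqn _ _ x30' u20; lra.
have [u00|u00] := eqVneq u0 0.
  have u10 : u1 != 0 by move: u; rewrite u20 u00 eqxx orbF.
  have qE : q = u1 by rewrite /q u20 mulr0 addr0.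
  by have := sqn _ _ x20 u10; rewrite qE; lra.
have pE : p = u0 by rewrite /p u20 mulr0 addr0.
by have := sqn _ _ x10 u00; rewrite pE; lra.
Qed.

(* A zero pivot x_i forces the off-diagonal entry to vanish, which makes the   *)
(* convention [y / 0 = 0] harmless.                                            *)
Definition psd_coords (x1 x2 x3 x4 x5 : R) : Prop :=
  [/\ 0 <= x1 /\ (x1 = 0 -> x4 = 0), 0 <= x2 /\ (x2 = 0 -> x5 = 0) &
      x4 ^+ 2 / x1 + x5 ^+ 2 / x2 <= x3].

Lemma linear_ge0 (a b : R) : (forall r, 0 <= a + b * r) -> b = 0.
Proof.
move=> H; apply/eqP/negPn/negP => b0.
have := H (- (a + 1) / b); rewrite mulrCA divff // mulr1; lra.
Qed.

Lemma psd_coordsP x1 x2 x3 x4 x5 :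
  (forall u0 u1 u2, 0 <= qform u0 u1 u2 (symx x1 x2 x3 x4 x5)) ->
  psd_coords x1 x2 x3 x4 x5.
Proof.
move=> H; have {}H u0 u1 u2 := H u0 u1 u2.
have x10 : 0 <= x1 by have := H 1 0 0; rewrite qform_symx; lra.
have x20 : 0 <= x2 by have := H 0 1 0; rewrite qform_symx; lra.
have x4E : x1 = 0 -> x4 = 0.
  (* When x1 = 0 the form at (r / 2, 0, 1) is the affine function x3 + x4 r. *)
  move=> x1E; apply: (@linear_ge0 x3) => r.
  by have := H (r / 2) 0 1; rewrite qform_symx x1E; lra.
have x5E : x2 = 0 -> x5 = 0.
  move=> x2E; apply: (@linear_ge0 x3) => r.
  by have := H 0 (r / 2) 1; rewrite qform_symx x2E; lra.
split=> //; have := H (- (x4 / x1)) (- (x5 / x2)) 1; rewrite qform_symx.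
have pivot (x y : R) : (x = 0 -> y = 0) -> x * (y / x) ^+ 2 = y ^+ 2 / x.
  have [-> /(_ erefl) ->|x0 _] := eqVneq x 0; first by rewrite !mul0r expr0n /= mul0r.
  by field.
rewrite !sqrrN !pivot //; lra.
Qed.

(** Enlarging the first two pivots can only lower the subtracted quotients, while the last diagonal
    entry gains e. *)
Lemma psd_coords_Omega x1 x2 x3 x4 x5 e : 0 < e -> psd_coords x1 x2 x3 x4 x5 ->
  Omega (symx (x1 + e) (x2 + e) (x3 + e) x4 x5).
Proof.
move=> e0 [[x10 x4E] [x20 x5E] x3E]; apply/Omega_symx; split; [lra|lra|].
have pivot (x y : R) : 0 <= x -> (x = 0 -> y = 0) -> y ^+ 2 / (x + e) <= y ^+ 2 / x.
  rewrite le_eqVlt => /predU1P[<- /(_ erefl) ->|x0 _].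
    by rewrite expr0n /= !mul0r.
  by rewrite ler_wpM2l ?sqr_ge0 // lef_pV2 ?posrE; lra.
have := pivot _ _ x10 x4E; have := pivot _ _ x20 x5E; lra.
Qed.

(** Turns a neighbourhood into a statement about small positive steps in a direction [m]: these
    produce points of [Omega] near a boundary point, and leave [C] or [Gamma] at a boundary
    point. *)
Lemma near_line (T : normedModType R) (g m : T) (B : set T) : nbhs g B ->
  \forall e \near (0 : R)^'+, B (g + e *: m).
Proof.
move=> gB; have : (fun e : R => g + e *: m) e @[e --> (0 : R)^'+] --> g.
  rewrite -[X in _ --> X]addr0 -(scale0r m).
  apply: cvgD; first exact: cvg_cst.
  by apply: cvgZr_tmp; apply: cvg_at_right_filter; exact: cvg_id.
exact.
Qed.

Lemma qform_continuous u0 u1 u2 : continuous (qform u0 u1 u2).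
Proof.
move=> x.
have c i j v : {for x, continuous (fun y : 'M[R]_3 => y i j * v)}.
  by apply: continuousM; [exact: coord_continuous | exact: cst_continuous].
exact: (continuousD (continuousD (continuousD (continuousD (c _ _ _) (c _ _ _))
  (c _ _ _)) (c _ _ _)) (c _ _ _)).
Qed.

Lemma Omega_cl_symx x1 x2 x3 x4 x5 : Omega_cl (symx x1 x2 x3 x4 x5) <->
  psd_coords x1 x2 x3 x4 x5.
Proof.
split=> [[_ clx]|P].
  apply: psd_coordsP => u0 u1 u2.
  have cl : closed [set x | 0 <= qform u0 u1 u2 x].
    apply: (closed_comp _ (@closed_ge R 0)) => x _; exact: qform_continuous.
  apply: cl; apply: closure_subset clx => x Ox /=.
  have Vx := Ox.1.
  have [/and3P[/eqP -> /eqP -> /eqP ->]|n0] := boolP [&& u0 == 0, u1 == 0 & u2 == 0].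
    by rewrite /qform expr0n /= !(mulr0, addr0).
  by apply/ltW; apply: (OmegaE Vx).1 => //; rewrite !negb_and in n0.
split; first exact: V_symx.
move=> B /(near_line 1%:M) nB.
have /filter_ex[e [Be e0]] : \forall e \near (0 : R)^'+,
    B (symx x1 x2 x3 x4 x5 + e *: 1%:M) /\ 0 < e.
  by apply: filterI => //; exact: nbhs_right_gt.
exists (symx x1 x2 x3 x4 x5 + e *: 1%:M); split => //.
rewrite mx3_scalar mx3Z mx3D !(mulr0, mulr1, addr0).
exact: psd_coords_Omega.
Qed.

End Cone.

(** * The compression criterion *)

Section Action.
Variable R : realType.
Implicit Types (s t : strip R).

Definition strip_y1 s (x : R) : R := (sa s * x + sb s) / (sc s * x + sd s).

Definition strip_y4 s (a3 x x4 : R) : R :=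
  (sar s * x + a3 * x4 + sbr s) / (sc s * x + sd s).

Lemma denom_Gmx s t (a3 b3 d3 x1 x2 x3 x4 x5 : R) :
  denom (Gmx s t a3 b3 d3) (symx x1 x2 x3 x4 x5) =
  mx3 (sc s * x1 + sd s) 0 (sc s * x4 + sdc s)
      0 (sc t * x2 + sd t) (sc t * x5 + sdc t) 0 0 d3.
Proof.
rewrite /denom /Gmx block_mxKdl block_mxKdr mx3M mx3D.
by congr mx3; ring.
Qed.

(** The stated image times C x + D is compared with A x + B entry by entry, and the invertible
    denominator is cancelled. The symplectic relations enter only in the entries (0,2) and (1,2),
    through [entry13]. *)
Lemma act_Gmx s t (a3 b3 d3 x1 x2 x3 x4 x5 : R) : a3 * d3 = 1 ->
  strip_rel a3 s -> strip_rel a3 t ->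
  sc s * x1 + sd s != 0 -> sc t * x2 + sd t != 0 ->
  act (Gmx s t a3 b3 d3) (symx x1 x2 x3 x4 x5) =
  symx (strip_y1 s x1) (strip_y1 t x2)
    (a3 * (a3 * x3 + b3
      + (sar s * x4 - strip_y4 s a3 x1 x4 * (sc s * x4 + sdc s))
      + (sar t * x5 - strip_y4 t a3 x2 x5 * (sc t * x5 + sdc t))))
    (strip_y4 s a3 x1 x4) (strip_y4 t a3 x2 x5).
Proof.
move=> ad3 rs rt ds dt.
have d30 : d3 != 0 by apply: contra_eq_neq ad3 => ->; rewrite mulr0 eq_sym oner_neq0.
have a30 : a3 != 0 by apply: contra_eq_neq ad3 => ->; rewrite mul0r eq_sym oner_neq0.
have entry13 r (x z : R) : strip_rel a3 r -> sc r * x + sd r != 0 ->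
    sa r * z + sbc r =
    strip_y1 r x * (sc r * z + sdc r) + strip_y4 r a3 x z * d3.
  case: r => a b c d ar br bc dc [/= r1 r2 r3] dn; rewrite /strip_y1 /strip_y4 /=.
  apply: (mulfI dn); apply: (mulfI a30).
  transitivity (a3 * a * z * (c * x + d) + (a * br - ar * b) * (c * x + d)).
    by rewrite r3; ring.
  transitivity ((a * x + b) * (a3 * c * z + (br * c - ar * d))
      + (a3 * d3) * (ar * x + a3 * z + br)).
    rewrite ad3; transitivity (a3 * c * z * (a * x + b) + a3 * z * (a * d - b * c)
        + (a * br - ar * b) * (c * x + d)); first by ring.
    rewrite r1; transitivity (a3 * c * z * (a * x + b) + a3 * z
        + (a * x + b) * (br * c - ar * d) + (ar * x + br) * (a * d - b * c)).
      by ring.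
    by rewrite r1; ring.
  by rewrite -r2; field.
set y4 := strip_y4 s _ _ _; set y5 := strip_y4 t _ _ _.
have du : denom (Gmx s t a3 b3 d3) (symx x1 x2 x3 x4 x5) \in unitmx.
  by rewrite denom_Gmx mx3_upper_unit ds dt d30.
rewrite /act; apply: (can_inj (mulmxK du)); rewrite mulmxKV // denom_Gmx.
rewrite /Gmx block_mxKul block_mxKur /symx !mx3M mx3D.
have e1 r (x : R) : sc r * x + sd r != 0 ->
    strip_y1 r x * (sc r * x + sd r) = sa r * x + sb r.
  by move=> ?; rewrite /strip_y1 divfK.
have e4 r (x z : R) : sc r * x + sd r != 0 ->
    strip_y4 r a3 x z * (sc r * x + sd r) = sar r * x + a3 * z + sbr r.
  by move=> ?; rewrite /strip_y4 divfK.
have := e1 _ _ ds; have := e1 _ _ dt; have := e4 _ _ x4 ds; have := e4 _ _ x5 dt.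
have := entry13 _ _ x4 rs ds; have := entry13 _ _ x5 rt dt; rewrite -/y4 -/y5.
move: (strip_y1 s x1) (strip_y1 t x2) y4 y5 => y1 y2 y4 y5 f5 f4 f3 f2 f1 f0.
congr mx3; rewrite ?(mulr0, mul0r, addr0, add0r) //.
by rewrite -[_ * d3]mulrC !mulrA [d3 * a3]mulrC ad3 mul1r; ring.
Qed.

(* [a3 ^+ 2 * x3 + a3 * b3 - strip_loss s - strip_loss t] is the last pivot of *)
(* the image point.                                                            *)
Definition strip_loss s (a3 x x4 : R) : R :=
  a3 * (a3 * sa s * x4 ^+ 2 + 2 * a3 * sbc s * x4 + sbc s * (sar s * x + sbr s))
  / (sa s * x + sb s).

(** Since [sa s] and a3 are nonzero, the relations express [sd], [sbr] and [sdc] by the other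
    entries; what remains is a rational identity in which the factor c x + d cancels. *)
Lemma strip_lossE s (a3 x x4 : R) : 0 < a3 -> strip_rel a3 s -> sa s != 0 ->
  sc s * x + sd s != 0 -> sa s * x + sb s != 0 ->
  strip_y4 s a3 x x4 ^+ 2 / strip_y1 s x
  - a3 * (sar s * x4 - strip_y4 s a3 x x4 * (sc s * x4 + sdc s))
  = strip_loss s a3 x x4.
Proof.
case: s => a b c d ar br bc dc a30 [/= r1 r2 r3] an dn nn.
rewrite /strip_loss /strip_y1 /strip_y4 /=; rewrite /= in dn nn.
have a3n : a3 != 0 by rewrite gt_eqF.
have dE : d = (1 + b * c) / a by rewrite -r1; field.
have brE : br = (ar * b + a3 * bc) / a by rewrite -r3; field.
have dcE : dc = (br * c - ar * d) / a3 by rewrite -r2; field.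
move: dn; rewrite dcE brE dE => dn.
have dn' : a * c * x + (1 + b * c) != 0.
  rewrite (_ : _ + _ = a * (c * x + (1 + b * c) / a)) ?mulf_neq0 //; by field.
field; rewrite an a3n nn /=.
by rewrite [X in X != 0](_ : _ = a * c * x + (1 + b * c)) //; ring.
Qed.

(** The entry [sd] needs no clause: a d = 1 + b c is positive once b c is nonnegative. The last
    clause is the condition attached to a zero pivot, as in [psd_coords]. *)
Definition strip_nonneg s : Prop :=
  [/\ sa s != 0, 0 <= sa s * sb s, 0 <= sa s * sc s & (sb s = 0 -> sbc s = 0)].

(** Completing the square in x4 separates the contribution of x, that of the block B, and a square
    with a favourable sign. *)
Lemma strip_loss_square s (a3 x x4 : R) : 0 < a3 -> strip_rel a3 s ->
  strip_nonneg s -> 0 < x ->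
  strip_loss s a3 x x4 = a3 ^+ 2 * (x4 ^+ 2 / x) + a3 * (sbr s * sbc s / sb s)
    - a3 ^+ 2 * ((sb s * x4 - x * sbc s) ^+ 2 / (x * (sb s * (sa s * x + sb s)))).
Proof.
case: s => a b c d ar br bc dc a30 [/= r1 r2 r3] [/= an ab ac b0] x0.
rewrite /strip_loss /=.
have xn : x != 0 by rewrite gt_eqF.
have nn : a * x + b != 0.
  apply/eqP => E; have : 0 < a * (a * x + b).
    by rewrite mulrDr mulrA -expr2 ltr_pwDl // mulr_gt0 // exprn_even_gt0.
  by rewrite E mulr0 ltxx.
have brE : br = (ar * b + a3 * bc) / a by rewrite -r3; field.
(* If b = 0 then [sbc] vanishes too, and the quotients by b are 0 by the convention on division. *)
have [bE|bn] := eqVneq b 0.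
  move: nn; rewrite (b0 bE) bE !(mulr0, mul0r, addr0, subr0) invr0 !mulr0 subr0.
  by move=> _; field; rewrite an xn.
by rewrite brE; field; rewrite an xn nn bn.
Qed.

(** The factor [sa s] absorbs the common sign of the entries and avoids a case distinction. *)
Lemma strip_denom_gt0 s (a3 x : R) : strip_rel a3 s -> strip_nonneg s -> 0 < x ->
  0 < sa s * (sc s * x + sd s).
Proof.
case: s => a b c d ar br bc dc [/= r1 _ _] [/= an ab ac _] x0.
have bc0 : 0 <= b * c.
  rewrite -(@pmulr_rge0 _ (a ^+ 2)) ?exprn_even_gt0 //.
  by rewrite [X in 0 <= X](_ : _ = (a * b) * (a * c)); [exact: mulr_ge0 | ring].
have : 0 <= a * c * x by rewrite mulr_ge0 // ltW.
rewrite (_ : a * (c * x + d) = a * c * x + (a * d - b * c) + b * c); last by ring.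
rewrite r1; lra.
Qed.

Lemma strip_num_gt0 s (x : R) : strip_nonneg s -> 0 < x ->
  0 < sa s * (sa s * x + sb s).
Proof.
case: s => a b c d ar br bc dc [/= an ab ac _] x0.
by rewrite mulrDr mulrA -expr2 ltr_pwDl // mulr_gt0 // exprn_even_gt0.
Qed.

Lemma strip_y1_gt0 s (a3 x : R) : strip_rel a3 s -> strip_nonneg s -> 0 < x ->
  sc s * x + sd s != 0 /\ 0 < strip_y1 s x.
Proof.
move=> rs ns x0; have := strip_denom_gt0 rs ns x0; have := strip_num_gt0 ns x0.
have [an _ _ _] := ns; rewrite /strip_y1; set p := _ + sb s; set q := _ + sd s => ap aq.
have q0 : q != 0 by apply/eqP => E; rewrite E mulr0 ltxx in aq.
split=> //; rewrite -(@pmulr_lgt0 _ ((sa s * q) ^+ 2)) ?exprn_gt0 //.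
rewrite [X in 0 < X](_ : _ = (sa s * p) * (sa s * q)); [exact: mulr_gt0 | by field].
Qed.

(** If a b or c d were negative, the Moebius map would have a zero or a pole on the half-line; the
    sign of a c then follows from the value at 1. *)
Lemma strip_nonneg_half_line s (a3 : R) : strip_rel a3 s ->
  (forall x, 0 < x -> sc s * x + sd s != 0 /\ 0 < strip_y1 s x) ->
  [/\ sa s != 0, 0 <= sa s * sb s & 0 <= sa s * sc s].
Proof.
case: s => a b c d ar br bc dc [/= r1 _ _]; rewrite /strip_y1 /= => H.
have P x : 0 < x -> 0 < (a * x + b) * (c * x + d).
  move=> /H[q0]; rewrite -(@pmulr_lgt0 _ ((c * x + d) ^+ 2)) ?exprn_even_gt0 //.
  by rewrite [X in 0 < X](_ : _ = (a * x + b) * (c * x + d)) //; field.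
have an : a != 0.
  (* With a = 0 the product (a x + b) (c x + d) is b d - x, which is negative at x = |b d| + 1. *)
  apply/eqP => a0; have bcE : b * c = - 1 by rewrite -r1 a0; ring.
  have := P (`|b * d| + 1) ltac:(by rewrite ltr_pwDr).
  rewrite a0 mul0r add0r mulrDr mulrA bcE.
  have := ler_norm (b * d); lra.
have root0 (p q : R) : p * q < 0 -> 0 < - q / p /\ p * (- q / p) + q = 0.
  move=> pq; have pn : p != 0 by apply/eqP => E; rewrite E mul0r ltxx in pq.
  split; last by field.
  rewrite -(@pmulr_lgt0 _ (p ^+ 2)) ?exprn_even_gt0 //.
  rewrite [X in 0 < X](_ : _ = - (p * q)); first by rewrite oppr_gt0.
  by field.
have ab : 0 <= a * b.
  by rewrite leNgt; apply/negP => /root0[/P + E]; rewrite E mul0r ltxx.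
have cd : 0 <= c * d.
  by rewrite leNgt; apply/negP => /root0[/P + E]; rewrite E mulr0 ltxx.
split=> //; have [->|cn] := eqVneq c 0; first by rewrite mulr0.
have an2 : 0 < a ^+ 2 by rewrite exprn_even_gt0.
have cn2 : 0 < c ^+ 2 by rewrite exprn_even_gt0.
have := P 1 ltr01; rewrite !mulr1 => P1.
rewrite -(@pmulr_lge0 _ ((a + b) * (c + d))) //.
rewrite [X in 0 <= X](_ : _ = (a ^+ 2 + a * b) * (c ^+ 2 + c * d)); last by ring.
by rewrite mulr_ge0 // addr_ge0 // ltW.
Qed.

(* The last condition says that the Schur complement of the block B of g is    *)
(* nonnegative.                                                                *)
Definition strips_compress s t (b3 : R) : Prop :=
  [/\ strip_nonneg s, strip_nonneg t &
      sbr s * sbc s / sb s + sbr t * sbc t / sb t <= b3].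

Lemma Omega_act s t (a3 b3 d3 x1 x2 x3 x4 x5 : R) : 0 < a3 -> a3 * d3 = 1 ->
  strip_rel a3 s -> strip_rel a3 t -> sa s != 0 -> sa t != 0 ->
  sc s * x1 + sd s != 0 -> sc t * x2 + sd t != 0 ->
  Omega (act (Gmx s t a3 b3 d3) (symx x1 x2 x3 x4 x5)) <->
  [/\ 0 < strip_y1 s x1, 0 < strip_y1 t x2 &
    strip_loss s a3 x1 x4 + strip_loss t a3 x2 x5 < a3 ^+ 2 * x3 + a3 * b3].
Proof.
move=> a30 ad3 rs rt an1 an2 dn1 dn2; rewrite act_Gmx // Omega_symx.
have num r x : 0 < strip_y1 r x -> sa r * x + sb r != 0.
  by apply: contraTneq; rewrite /strip_y1 => ->; rewrite mul0r ltxx.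
split=> -[y1 y2 y3]; split=> //; move: y3.
  by rewrite -!strip_lossE ?num //; lra.
by rewrite -!strip_lossE ?num //; lra.
Qed.

Lemma Gamma_Gmx s t (a3 b3 d3 : R) : 0 < a3 -> a3 * d3 = 1 ->
  strip_rel a3 s -> strip_rel a3 t ->
  Gamma (Gmx s t a3 b3 d3) <-> strips_compress s t b3.
Proof.
move=> a30 ad3 rs rt.
have d30 : d3 != 0 by apply: contra_eq_neq ad3 => ->; rewrite mulr0 eq_sym oner_neq0.
have unitE x1 x2 x3 x4 x5 : (denom (Gmx s t a3 b3 d3) (symx x1 x2 x3 x4 x5) \in unitmx)
    = (sc s * x1 + sd s != 0) && (sc t * x2 + sd t != 0).
  by rewrite denom_Gmx mx3_upper_unit d30 andbT.
split=> [[_ H]|[ns nt sch]]; last first.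
  split=> [|x Ox]; first exact: G_Gmx.
  have xE := VE Ox.1; move: Ox; rewrite {}xE; move: (x 0 0) (x 1 1) (x 2 2) (x 2 0) (x 2 1) => x1 x2 x3 x4 x5 {x}.
  move=> /Omega_symx[x10 x20 x30].
  have [dn1 y1] := strip_y1_gt0 rs ns x10; have [dn2 y2] := strip_y1_gt0 rt nt x20.
  rewrite unitE dn1 dn2; split=> //; apply/Omega_act => //; [by case: ns|by case: nt|].
  split=> //; rewrite !strip_loss_square //.
  have sq r x z : strip_nonneg r -> 0 < x -> 0 <= a3 ^+ 2 *
      ((sb r * z - x * sbc r) ^+ 2 / (x * (sb r * (sa r * x + sb r)))).
    move=> nr x0; rewrite mulr_ge0 ?sqr_ge0 // mulr_ge0 ?sqr_ge0 // invr_ge0.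
    have num := strip_num_gt0 nr x0; case: nr => an ab _ _.
    rewrite mulr_ge0 ?(ltW x0) // -(@pmulr_rge0 _ (sa r ^+ 2)) ?exprn_even_gt0 //.
    by rewrite [X in 0 <= X](_ : _ = (sa r * sb r) * (sa r * (sa r * x + sb r)));
      [apply: mulr_ge0 => //; exact: ltW | ring].
  have := sq _ _ x4 ns x10; have := sq _ _ x5 nt x20.
  have : a3 * (sbr s * sbc s / sb s + sbr t * sbc t / sb t) <= a3 * b3.
    by rewrite ler_pM2l.
  have : a3 ^+ 2 * (x4 ^+ 2 / x1 + x5 ^+ 2 / x2) < a3 ^+ 2 * x3.
    by rewrite ltr_pM2l // exprn_gt0.
  lra.
have {}H x1 x2 x3 x4 x5 : 0 < x1 -> 0 < x2 -> x4 ^+ 2 / x1 + x5 ^+ 2 / x2 < x3 ->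
    [/\ sc s * x1 + sd s != 0, sc t * x2 + sd t != 0 &
        Omega (act (Gmx s t a3 b3 d3) (symx x1 x2 x3 x4 x5))].
  move=> x10 x20 x30; have /H[] : Omega (symx x1 x2 x3 x4 x5) by apply/Omega_symx.
  by rewrite unitE => /andP[].
have H1 x : 0 < x -> sc s * x + sd s != 0 /\ 0 < strip_y1 s x.
  move=> x0; have [|dn1 dn2] := H x 1 1 0 0 x0 ltr01.
    by rewrite expr0n /= !mul0r addr0 ltr01.
  by rewrite act_Gmx // => /Omega_symx[].
have H2 x : 0 < x -> sc t * x + sd t != 0 /\ 0 < strip_y1 t x.
  move=> x0; have [|dn1 dn2] := H 1 x 1 0 0 ltr01 x0.
    by rewrite expr0n /= !mul0r addr0 ltr01.
  by rewrite act_Gmx // => /Omega_symx[].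
have [an1 ab1 ac1] := strip_nonneg_half_line rs H1.
have [an2 ab2 ac2] := strip_nonneg_half_line rt H2.
have {}H x1 x2 x3 x4 x5 : 0 < x1 -> 0 < x2 -> x4 ^+ 2 / x1 + x5 ^+ 2 / x2 < x3 ->
    strip_loss s a3 x1 x4 + strip_loss t a3 x2 x5 < a3 ^+ 2 * x3 + a3 * b3.
  move=> x10 x20 x30; have [dn1 dn2] := H x1 x2 x3 x4 x5 x10 x20 x30.
  by case/Omega_act.
(* For b = 0 the loss at x4 = 0 is N + M / x, with M > 0 unless [sbc] vanishes, so it is unbounded
   as x tends to 0. The value x = M / (|K - N| + 1) makes it exceed K. *)
have pinch r (K : R) : strip_rel a3 r -> sa r != 0 -> sb r = 0 ->
    (forall x, 0 < x -> strip_loss r a3 x 0 < K) -> sbc r = 0.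
  case: r => a b c d ar br bc dc [/= r1 _ r3] /= an b0.
  rewrite /strip_loss /= => L; apply/eqP/negPn/negP => bcn.
  have brE : br = a3 * bc / a.
    by apply: (mulfI an); rewrite r3 b0; field.
  set M := (a3 * bc / a) ^+ 2.
  have M0 : 0 < M.
    by rewrite exprn_even_gt0 // !mulf_neq0 ?invr_eq0 // gt_eqF.
  set N := a3 * bc * ar / a.
  have K0 : 0 < `|K - N| + 1 by rewrite ltr_pwDr.
  have x0 : 0 < M / (`|K - N| + 1) by rewrite divr_gt0.
  have := L _ x0; rewrite [X in X < _](_ : _ = N + M / (M / (`|K - N| + 1))).
    rewrite invf_div mulrCA divff ?mulr1 ?gt_eqF //.
    have := ler_norm (K - N); lra.
  move: x0; move: (M / (_ + 1)) => x x0; rewrite b0 brE /M /N; field.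
  by rewrite an gt_eqF.
have ns : strip_nonneg s.
  split=> // b0; apply: (@pinch s (a3 ^+ 2 * 1 + a3 * b3 - strip_loss t a3 1 0)) => // x x0.
  have := H x 1 1 0 0 x0 ltr01; rewrite expr0n /= !mul0r addr0 ltr01 => /(_ isT); lra.
have nt : strip_nonneg t.
  split=> // b0; apply: (@pinch t (a3 ^+ 2 * 1 + a3 * b3 - strip_loss s a3 1 0)) => // x x0.
  have := H 1 x 1 0 0 ltr01 x0; rewrite expr0n /= !mul0r addr0 ltr01 => /(_ isT); lra.
split=> //; apply/ler_addgt0Pr => e e0.
(* At x1 = x2 = 1 these off-diagonal entries make both squares vanish, so the Schur inequality is
   tested up to e; a zero pivot gives z = 0, which is also correct. *)
pose z1 := sbc s / sb s; pose z2 := sbc t / sb t.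
have := H 1 1 (z1 ^+ 2 + z2 ^+ 2 + e / a3) z1 z2 ltr01 ltr01.
rewrite !divr1 ltrDl divr_gt0 // => /(_ isT); rewrite !strip_loss_square //.
have sq0 r : strip_nonneg r -> sb r * (sbc r / sb r) - 1 * sbc r = 0.
  case=> _ _ _; have [-> /(_ erefl) ->|n0 _] := eqVneq (sb r) 0.
    by rewrite !mul0r mulr0 subr0.
  by field.
rewrite !sq0 // expr0n /= !mul0r !mulr0 !divr1 !subr0 => L.
rewrite -(ler_pM2l a30) ltW //.
have -> : a3 * (b3 + e) = a3 ^+ 2 * (e / a3) + a3 * b3 by field; rewrite gt_eqF.
lra.
Qed.

End Action.

(** * The exponential *)

Section Exponential.
Variable R : realType.
Implicit Types (w : nat -> R) (p : R).

Definition exp_sum w (l : R) : Prop :=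
  series (fun k => (k`!%:R)^-1 * w k) @ \oo --> l.

Lemma exp_sumD w w' (l l' : R) : exp_sum w l -> exp_sum w' l' ->
  exp_sum (fun k => w k + w' k) (l + l').
Proof.
move=> h h'; rewrite /exp_sum (_ : series _ =
  series (fun k => (k`!%:R)^-1 * w k) \+ series (fun k => (k`!%:R)^-1 * w' k)).
  exact: cvgD.
apply: funext => n; rewrite /series /= -big_split /=.
by apply: eq_bigr => k _; rewrite mulrDr.
Qed.

Lemma exp_sumZ a w (l : R) : exp_sum w l -> exp_sum (fun k => a * w k) (a * l).
Proof.
move=> h; rewrite /exp_sum (_ : series _ =
  fun n => a * series (fun k => (k`!%:R)^-1 * w k) n).
  exact: cvgMl_tmp.
apply: funext => n; rewrite /series /= mulr_sumr.
by apply: eq_bigr => k _; rewrite mulrCA.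
Qed.

Lemma exp_sum0 : exp_sum (fun=> 0) 0.
Proof.
rewrite /exp_sum (_ : series _ = fun=> 0); first exact: cvg_cst.
by apply: funext => n; rewrite /series /= big1 // => k _; rewrite mulr0.
Qed.

Lemma exp_sum_indic m : exp_sum (fun k => (k == m)%:R) (m`!%:R)^-1.
Proof.
apply: cvg_near_cst; exists m.+1 => // n /= mn.
rewrite /series /= (bigD1_seq m) ?iota_uniq //=.
  rewrite eqxx mulr1 big1 ?addr0 // => k /negbTE ->; by rewrite mulr0.
by rewrite mem_index_iota.
Qed.

Definition even_part p k : R := if odd k then 0 else p ^+ k./2.
Definition odd_part p k : R := if odd k then p ^+ k./2 else 0.
Definition shift w k : R := if k is k'.+1 then w k' else 0.

Definition sum_exp w : R := limn (series (fun k => (k`!%:R)^-1 * w k)).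

(* For p = r ^+ 2 > 0 these are cosh r, sinh r / r, (cosh r - 1) / r ^+ 2 and *)
(* (sinh r / r - 1) / r ^+ 2; all four are entire functions of p.             *)
Definition ch p : R := sum_exp (even_part p).
Definition sh p : R := sum_exp (odd_part p).
Definition ch1 p : R := sum_exp (shift (odd_part p)).
Definition sh1 p : R := sum_exp (shift (shift (odd_part p))).

(** Comparison with the exponential series at 1 + p. The base 1 + p is at least 1, so its powers
    grow with the exponent and dominate p ^+ k./2. *)
Lemma sum_expP p w : 0 <= p -> (forall k, 0 <= w k <= (1 + p) ^+ k) ->
  exp_sum w (sum_exp w).
Proof.
move=> p0 wb; apply: (@series_le_cvg _ _ (exp_coeff (1 + p))).
- by move=> k; rewrite mulr_ge0 ?invr_ge0 //; case/andP: (wb k).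
- by move=> k; rewrite /exp_coeff /= divr_ge0 // exprn_ge0 // addr_ge0.
- move=> k; rewrite /exp_coeff /= mulrC ler_wpM2r ?invr_ge0 //.
  by case/andP: (wb k).
- exact: is_cvg_series_exp_coeff.
Qed.

Lemma sum_exp_ge0 p w : 0 <= p -> (forall k, 0 <= w k <= (1 + p) ^+ k) ->
  0 <= sum_exp w.
Proof.
move=> p0 wb; apply: limr_ge; first exact: sum_expP wb.
apply: nearW => n; apply: sumr_ge0 => k _.
by rewrite mulr_ge0 ?invr_ge0 //; case/andP: (wb k).
Qed.

Lemma parts_bound p k m : 0 <= p -> (m <= k)%N -> 0 <= p ^+ m <= (1 + p) ^+ k.
Proof.
move=> p0 mk; rewrite exprn_ge0 //= (@le_trans _ _ ((1 + p) ^+ m)) //.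
  by rewrite lerXn2r ?nnegrE //; lra.
by rewrite ler_weXn2l //; lra.
Qed.

Lemma half_le k : (k./2 <= k)%N.
Proof. by rewrite -{2}(odd_double_half k) -addnn addnA leq_addl. Qed.

Lemma zero_bound p k : 0 <= p -> (0 : R) <= 0 <= (1 + p) ^+ k.
Proof. by move=> p0; rewrite lexx exprn_ge0 // addr_ge0. Qed.

Lemma even_part_bound p k : 0 <= p -> 0 <= even_part p k <= (1 + p) ^+ k.
Proof.
move=> p0; rewrite /even_part; case: ifP => _; first exact: zero_bound.
exact: parts_bound (half_le k).
Qed.

Lemma odd_part_bound p k : 0 <= p -> 0 <= odd_part p k <= (1 + p) ^+ k.
Proof.
move=> p0; rewrite /odd_part; case: ifP => _; last exact: zero_bound.
exact: parts_bound (half_le k).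
Qed.

Lemma shift_bound p w k : 0 <= p -> (forall k, 0 <= w k <= (1 + p) ^+ k) ->
  0 <= shift w k <= (1 + p) ^+ k.
Proof.
move=> p0 wb; case: k => [|k] /=; first exact: zero_bound.
case/andP: (wb k) => -> wk /=; rewrite (le_trans wk) //.
by rewrite ler_weXn2l //; lra.
Qed.

Section NonnegativeArgument.
Variable p : R.
Hypothesis p0 : 0 <= p.

Lemma ch_sum : exp_sum (even_part p) (ch p).
Proof. by apply: (sum_expP p0) => k; exact: even_part_bound. Qed.

Lemma sh_sum : exp_sum (odd_part p) (sh p).
Proof. by apply: (sum_expP p0) => k; exact: odd_part_bound. Qed.

Lemma ch1_sum : exp_sum (shift (odd_part p)) (ch1 p).
Proof.
by apply: (sum_expP p0) => k; apply: shift_bound => // m; exact: odd_part_bound.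
Qed.

Lemma sh1_sum : exp_sum (shift (shift (odd_part p))) (sh1 p).
Proof.
apply: (sum_expP p0) => k; apply: shift_bound => // m.
by apply: shift_bound => // n; exact: odd_part_bound.
Qed.

Lemma even_part_shift k :
  even_part p k = (k == 0)%:R + p * shift (odd_part p) k.
Proof.
case: k => [|k] /=; first by rewrite mulr0 addr0.
rewrite /even_part /odd_part /= add0r uphalf_half.
by case: (odd k) => /=; rewrite ?mulr0 // -exprS.
Qed.

Lemma odd_part_shift k :
  odd_part p k = (k == 1)%:R + p * shift (shift (odd_part p)) k.
Proof.
case: k => [|[|k]] /=; rewrite ?mulr0 ?addr0 //.
rewrite /odd_part /= add0r negbK.
by case: (odd k); rewrite ?mulr0 // -exprS.
Qed.

Lemma exp_sum_unique w (l l' : R) : exp_sum w l -> exp_sum w l' -> l = l'.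
Proof. by move=> h h'; rewrite -(cvg_lim _ h) // -(cvg_lim _ h'). Qed.

(** Splitting off the constant term of the series replaces a division by p, which would fail at p =
    0. *)
Lemma chE : ch p = 1 + p * ch1 p.
Proof.
apply: (exp_sum_unique ch_sum); rewrite (funext even_part_shift).
have := @exp_sum_indic 0%N; rewrite invr1 => i.
exact: (exp_sumD i (@exp_sumZ p _ _ ch1_sum)).
Qed.

Lemma shE : sh p = 1 + p * sh1 p.
Proof.
apply: (exp_sum_unique sh_sum); rewrite (funext odd_part_shift).
have := @exp_sum_indic 1%N; rewrite invr1 => i.
exact: (exp_sumD i (@exp_sumZ p _ _ sh1_sum)).
Qed.

Lemma ch_gt0 : 0 < ch p.
Proof.
rewrite chE; apply: ltr_pwDl => //; apply: mulr_ge0 => //.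
by apply: (sum_exp_ge0 p0) => k; apply: shift_bound => // m; exact: odd_part_bound.
Qed.

Lemma sh_gt0 : 0 < sh p.
Proof.
rewrite shE; apply: ltr_pwDl => //; apply: mulr_ge0 => //.
apply: (sum_exp_ge0 p0) => k; apply: shift_bound => // m.
by apply: shift_bound => // n; exact: odd_part_bound.
Qed.

Lemma expR_ch_sh r : r ^+ 2 = p -> expR r = ch p + r * sh p.
Proof.
move=> rp; have := exp_sumD ch_sum (@exp_sumZ r _ _ sh_sum).
apply: exp_sum_unique.
rewrite (_ : (fun k => _) = fun k => r ^+ k); last first.
  apply: funext => k; rewrite /even_part /odd_part -rp -[in RHS](odd_double_half k).
  case: (odd k); first by rewrite add0r exprD expr1 -exprM -mul2n.
  by rewrite mulr0 addr0 -exprM -mul2n.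
rewrite /exp_sum (_ : (fun k => _) = exp_coeff r); first exact: is_cvg_series_exp_coeff.
by apply: funext => k; rewrite /exp_coeff /= mulrC.
Qed.

(** This is exp(r) exp(- r) = 1 for r the square root of p. *)
Lemma ch_sh_unit : ch p ^+ 2 - p * sh p ^+ 2 = 1.
Proof.
have rp : Num.sqrt p ^+ 2 = p by rewrite sqr_sqrtr.
have := expRxMexpNx_1 (Num.sqrt p); rewrite -(expR0 R) => <-.
rewrite (expR_ch_sh rp) (@expR_ch_sh (- Num.sqrt p)) ?sqrrN //.
by rewrite -{2}rp; ring.
Qed.

End NonnegativeArgument.

(** The left side is sinh(r)^2 for p = r^2, so r is the inverse hyperbolic sine of the square root
    of q, in its logarithmic form. *)
Lemma sh_surj q : 0 <= q -> exists2 p, 0 <= p & p * sh p ^+ 2 = q.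
Proof.
move=> q0; set a := Num.sqrt q; set b := Num.sqrt (1 + q).
have aE : a ^+ 2 = q by rewrite sqr_sqrtr.
have bE : b ^+ 2 = 1 + q by rewrite sqr_sqrtr // addr_ge0.
have a0 : 0 <= a by exact: sqrtr_ge0.
have b0 : 0 < b by rewrite sqrtr_gt0; lra.
set r := ln (a + b); exists (r ^+ 2); first exact: sqr_ge0.
have r0 := sqr_ge0 r.
have er : expR r = a + b by rewrite lnK // posrE ltr_wpDl.
have eN : expR (- r) = b - a.
  rewrite expRN er; apply: (@mulfI _ (a + b)); first by rewrite gt_eqF // ltr_wpDl.
  rewrite divff ?gt_eqF ?ltr_wpDl //.
  by rewrite [RHS](_ : _ = b ^+ 2 - a ^+ 2); [rewrite aE bE; ring | ring].
move: er eN; rewrite (expR_ch_sh r0 erefl) (@expR_ch_sh _ r0 (- r)) ?sqrrN // => er eN.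
by rewrite -exprMn -aE; congr (_ ^+ 2); lra.
Qed.

(** * Matrix exponentials, entry by entry *)

Definition mx_exp_sum m n (Y : nat -> 'M[R]_(m, n)) (E : 'M[R]_(m, n)) : Prop :=
  forall i j, exp_sum (fun k => Y k i j) (E i j).

Lemma mx_exp_sum_block m1 m2 n1 n2 A B U D
    (A' : 'M[R]_(m1, n1)) (B' : 'M[R]_(m1, n2))
    (U' : 'M[R]_(m2, n1)) (D' : 'M[R]_(m2, n2)) :
  mx_exp_sum A A' -> mx_exp_sum B B' -> mx_exp_sum U U' -> mx_exp_sum D D' ->
  mx_exp_sum (fun k => block_mx (A k) (B k) (U k) (D k)) (block_mx A' B' U' D').
Proof.
move=> hA hB hU hD i j; rewrite -(splitK i) -(splitK j).
case: (fintype.split i) => i'; case: (fintype.split j) => j' /=.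
- rewrite block_mxEul (_ : (fun k => _) = fun k => A k i' j'); first exact: hA.
  by apply: funext => k; rewrite block_mxEul.
- rewrite block_mxEur (_ : (fun k => _) = fun k => B k i' j'); first exact: hB.
  by apply: funext => k; rewrite block_mxEur.
- rewrite block_mxEdl (_ : (fun k => _) = fun k => U k i' j'); first exact: hU.
  by apply: funext => k; rewrite block_mxEdl.
- rewrite block_mxEdr (_ : (fun k => _) = fun k => D k i' j'); first exact: hD.
  by apply: funext => k; rewrite block_mxEdr.
Qed.

Lemma mx_exp_sum_mx3 (a b c d e f g h l : nat -> R) (a' b' c' d' e' f' g' h' l' : R) :
  exp_sum a a' -> exp_sum b b' -> exp_sum c c' ->
  exp_sum d d' -> exp_sum e e' -> exp_sum f f' ->
  exp_sum g g' -> exp_sum h h' -> exp_sum l l' ->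
  mx_exp_sum (fun k => mx3 (a k) (b k) (c k) (d k) (e k) (f k) (g k) (h k) (l k))
             (mx3 a' b' c' d' e' f' g' h' l').
Proof.
move=> ha hb hc hd he hf hg hh hl.
have eqf (i j : 'I_3) (w : nat -> R) t : t = exp_sum w (mx3 a' b' c' d' e' f' g' h' l' i j) ->
    (forall k, mx3 (a k) (b k) (c k) (d k) (e k) (f k) (g k) (h k) (l k) i j = w k) ->
    t -> exp_sum (fun k => mx3 (a k) (b k) (c k) (d k) (e k) (f k) (g k) (h k) (l k) i j)
           (mx3 a' b' c' d' e' f' g' h' l' i j).
  by move=> -> /funext ->.
case=> [[|[|[|//]]] i3] [[|[|[|//]]] j3];
  [apply: eqf ha|apply: eqf hb|apply: eqf hc|apply: eqf hd|apply: eqf he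
  |apply: eqf hf|apply: eqf hg|apply: eqf hh|apply: eqf hl] => *; by rewrite mxE.
Qed.

Lemma cvg_mx m n (Y : nat -> 'M[R]_(m, n)) (E : 'M[R]_(m, n)) :
  (forall i j, (fun k => Y k i j) @ \oo --> E i j) -> Y @ \oo --> E.
Proof.
move=> h B [P EP PB].
have : \forall k \near \oo, forall i j, P i j (Y k i j).
  by apply: filter_forall => i; apply: filter_forall => j; exact: h (EP i j).
by apply: filterS => k /PB.
Qed.

Lemma expmx_sum (X E : 'M[R]_(3 + 3)) :
  mx_exp_sum (fun k => X ^+ k) E -> expmx X = E.
Proof.
move=> h; apply/cvg_lim => //; apply: cvg_mx => i j.
rewrite (_ : (fun k => _) = series (fun k => (k`!%:R)^-1 * (X ^+ k) i j)); first exact: h.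
by apply: funext => n; rewrite /series /= summxE; apply: eq_bigr => k _; rewrite mxE.
Qed.

Definition odd_mx (u1 u2 v1 v2 v3 v4 v5 : R) : 'M[R]_(3 + 3) :=
  block_mx 0 (symx v1 v2 v3 v4 v5) (mx3 u1 0 0 0 u2 0 0 0 0) 0.

(** Every entry is linear in (c, s, c1), so one shape serves both the powers [X ^+ k], with
    coefficients of the series, and the exponential, with their sums. *)
Definition strip_of (u v v4 c s c1 : R) : strip R :=
  Strip c (v * s) (u * s) c (v4 * u * c1) (v4 * s) (v4 * s) (v4 * u * c1).

Lemma odd_mxX u1 u2 v1 v2 v3 v4 v5 k :
  odd_mx u1 u2 v1 v2 v3 v4 v5 ^+ k =
  Gmx (strip_of u1 v1 v4 (even_part (u1 * v1) k) (odd_part (u1 * v1) k)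
                         (shift (odd_part (u1 * v1)) k))
      (strip_of u2 v2 v5 (even_part (u2 * v2) k) (odd_part (u2 * v2) k)
                         (shift (odd_part (u2 * v2)) k))
      (k == 0)%:R
      (v3 * (k == 1)%:R + (v4 ^+ 2 * u1 * shift (shift (odd_part (u1 * v1))) k
                         + v5 ^+ 2 * u2 * shift (shift (odd_part (u2 * v2))) k))
      (k == 0)%:R.
Proof.
elim: k => [|k IH].
  rewrite expr0 -[1]/(1%:M) scalar_mx_block mx3_scalar mx3_0 /Gmx /strip_of /=.
  by rewrite /even_part /odd_part /= !(mulr0, addr0).
rewrite exprSr -[_ * _]/(_ *m _) IH /odd_mx /symx /Gmx /strip_of.
rewrite mulmx_block !mulmx0 !add0r !addr0 !mx3M.
have eS p : even_part p k.+1 = p * odd_part p k.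
  by rewrite even_part_shift add0r.
have oS p : odd_part p k.+1 = even_part p k.
  by rewrite /odd_part /even_part /= uphalf_half; case: (odd k).
rewrite !eS !oS /= eqSS; congr block_mx; congr mx3; rewrite ?(mulr0, mul0r, addr0, add0r) //;
  rewrite ?(even_part_shift (u1 * v1)) ?(even_part_shift (u2 * v2)); ring.
Qed.

Lemma expmx_odd u1 u2 v1 v2 v3 v4 v5 : 0 <= u1 * v1 -> 0 <= u2 * v2 ->
  expmx (odd_mx u1 u2 v1 v2 v3 v4 v5) =
  Gmx (strip_of u1 v1 v4 (ch (u1 * v1)) (sh (u1 * v1)) (ch1 (u1 * v1)))
      (strip_of u2 v2 v5 (ch (u2 * v2)) (sh (u2 * v2)) (ch1 (u2 * v2)))
      1 (v3 + (v4 ^+ 2 * u1 * sh1 (u1 * v1) + v5 ^+ 2 * u2 * sh1 (u2 * v2))) 1.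
Proof.
move=> p1 p2; apply: expmx_sum; rewrite (funext (odd_mxX _ _ _ _ _ _ _)).
have i0 := @exp_sum_indic 0%N; have i1 := @exp_sum_indic 1%N; rewrite invr1 in i0 i1.
have z := exp_sum0.
have [c1 s1 d1 t1] := And4 (ch_sum p1) (sh_sum p1) (ch1_sum p1) (sh1_sum p1).
have [c2 s2 d2 t2] := And4 (ch_sum p2) (sh_sum p2) (ch1_sum p2) (sh1_sum p2).
apply: mx_exp_sum_block; apply: mx_exp_sum_mx3 => //=; try exact: exp_sumZ.
apply: exp_sumD; last by apply: exp_sumD; exact: exp_sumZ.
by rewrite -[X in exp_sum _ X]mulr1; exact: exp_sumZ.
Qed.

End Exponential.

(** * Polar decomposition *)

Section Polar.
Variable R : realType.
Implicit Types (s t : strip R).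

(* A strip of the product of an element of G0 (entries e_i, e_{3+i}, e_3) with *)
(* the exponential of an element of the cone.                                  *)
Definition polar_strip (e er e3 u v v4 : R) : strip R :=
  let c := ch (u * v) in let s := sh (u * v) in let c1 := ch1 (u * v) in
  Strip (e * c) (e * (v * s)) (e^-1 * (u * s)) (e^-1 * c)
    (er * c + e3 * (v4 * u * c1)) (er * (v * s) + e3 * (v4 * s)) (e * (v4 * s))
    (e^-1 * (v4 * u * c1) - er / (e * e3)).

Definition cone_strip (u v v4 : R) : Prop :=
  [/\ 0 <= u, 0 <= v & v = 0 -> v4 = 0].

(** The three relations determine [sd], [sbr] and [sdc] from the other entries. *)
Lemma strip_eq s t (a3 : R) : a3 != 0 -> strip_rel a3 s -> strip_rel a3 t ->
  sa s != 0 -> sa s = sa t -> sb s = sb t -> sc s = sc t ->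
  sar s = sar t -> sbc s = sbc t -> s = t.
Proof.
case: s => a b c d ar br bc dc; case: t => a' b' c' d' ar' br' bc' dc' /= a3n.
move=> [/= r1 r2 r3] [/= r1' r2' r3'] an ea eb ec ear ebc.
move: r1' r2' r3'; rewrite -ea -eb -ec -ear -ebc => r1' r2' r3'.
have ed : d = d'.
  by apply: (mulfI an); rewrite -[LHS](subrK (b * c)) r1 -r1' subrK.
have ebr : br = br' by apply: (mulfI an); rewrite r3 r3'.
have -> // : dc = dc'.
by apply: (mulfI a3n); apply: (addrI (ar * d)); rewrite r2 ed r2' ebr.
by rewrite ed ebr.
Qed.

Lemma polar_strip_rel e er e3 u v v4 : e != 0 -> e3 != 0 -> cone_strip u v v4 ->
  strip_rel e3 (polar_strip e er e3 u v v4).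
Proof.
move=> en e3n [u0 v0 v4E]; have p0 := mulr_ge0 u0 v0.
have r1 := ch_sh_unit p0; have r2 := chE p0.
(* With p = u v, both p ch1 (ch + 1) and p sh^2 equal ch^2 - 1; dividing by p gives the claim, and
   for p = 0 the cone condition makes v4 u vanish. *)
have r3 : v4 * u * (ch1 (u * v) * (ch (u * v) + 1) - sh (u * v) ^+ 2) = 0.
  have [pE|pn] := eqVneq (u * v) 0.
    have /orP[/eqP ->|/eqP /v4E ->] : (u == 0) || (v == 0) by rewrite -mulf_eq0 pE.
      by rewrite mulr0 mul0r.
    by rewrite !mul0r.
  apply: (mulfI pn); rewrite mulr0; move: r1 r2; move: (ch _) (ch1 _) (sh _) => c c1 z r1 r2.
  have -> : u * v * (v4 * u * (c1 * (c + 1) - z ^+ 2)) =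
    v4 * u * (((1 + u * v * c1) - 1) * (c + 1) - u * v * z ^+ 2) by ring.
  rewrite -r2; transitivity (v4 * u * ((c ^+ 2 - u * v * z ^+ 2) - 1)); first by ring.
  by rewrite r1; ring.
rewrite /polar_strip; move: r1 r2 r3; move: (ch _) (ch1 _) (sh _) => c c1 z r1 r2 r3.
split=> /=.
- by rewrite -r1; field.
- apply/eqP; rewrite -subr_eq0; apply/eqP.
  transitivity (er / e * ((c ^+ 2 - u * v * z ^+ 2) - 1)
      + e3 / e * (v4 * u * (c1 * (c + 1) - z ^+ 2))); first by field; rewrite en e3n.
  by rewrite r1 r3; ring.
- apply/eqP; rewrite -subr_eq0; apply/eqP.
  transitivity (e * e3 * v4 * z * (c - (1 + u * v * c1))); first by ring.
  by rewrite -r2; ring.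
Qed.

Lemma polar_strip_ac e er e3 u v v4 : e != 0 -> sa (polar_strip e er e3 u v v4) *
  sc (polar_strip e er e3 u v v4) = u * (ch (u * v) * sh (u * v)).
Proof. by move=> en /=; field. Qed.

Lemma polar_strip_ab e er e3 u v v4 : sa (polar_strip e er e3 u v v4) *
  sb (polar_strip e er e3 u v v4) = v * (e ^+ 2 * (ch (u * v) * sh (u * v))).
Proof. by move=> /=; ring. Qed.

Lemma ch_sh_gt0 (p : R) : 0 <= p -> 0 < ch p * sh p.
Proof. by move=> p0; rewrite mulr_gt0 ?ch_gt0 ?sh_gt0. Qed.

Lemma polar_strip_nonneg e er e3 u v v4 : e != 0 -> cone_strip u v v4 ->
  strip_nonneg (polar_strip e er e3 u v v4).
Proof.
move=> en [u0 v0 v4E]; have p0 := mulr_ge0 u0 v0; have cs := ch_sh_gt0 p0.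
split.
- by rewrite /= mulf_neq0 // gt_eqF // ch_gt0.
- by rewrite polar_strip_ab mulr_ge0 // mulr_ge0 ?sqr_ge0 // ltW.
- by rewrite polar_strip_ac // mulr_ge0 // ltW.
- move=> /= /eqP; rewrite !mulf_eq0 (negbTE en) (gt_eqF (sh_gt0 p0)) orbF /=.
  by move=> /eqP /v4E ->; rewrite mul0r mulr0.
Qed.

(** By [shE] the quotient splits into e3 v4^2 / v and terms that recur in the corner entry of
    [G0mx_expmx]. After cancellation the Schur complement of B is e3 times the last pivot of v. *)
Lemma polar_strip_pivot e er e3 u v v4 : e != 0 -> cone_strip u v v4 ->
  let s := polar_strip e er e3 u v v4 in
  sbr s * sbc s / sb s =
  er * (v4 * sh (u * v)) + e3 * (v4 ^+ 2 / v + v4 ^+ 2 * u * sh1 (u * v)).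
Proof.
move=> en [u0 v0 v4E] /=; have p0 := mulr_ge0 u0 v0.
have [vE|vn] := eqVneq v 0.
  by rewrite (v4E vE) expr0n /= !(mul0r, mulr0, addr0).
have sn : sh (u * v) != 0 by rewrite gt_eqF // sh_gt0.
have sE := shE p0.
transitivity (er * (v4 * sh (u * v)) + e3 * v4 ^+ 2 / v * sh (u * v)).
  by field; rewrite vn sn en.
by rewrite [X in _ / v * X]sE; field.
Qed.

Lemma polar_strip_exists s (a3 : R) : 0 < a3 -> strip_rel a3 s -> strip_nonneg s ->
  exists e er u v v4, [/\ e != 0, cone_strip u v v4,
    s = polar_strip e er a3 u v v4, 0 < sa s * sb s -> 0 < v &
    0 < sa s * sc s -> 0 < u].
Proof.
move=> a30 rs [an ab ac b0].
have a3n : a3 != 0 by rewrite gt_eqF.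
have a2 : 0 < sa s ^+ 2 by rewrite exprn_even_gt0.
have q0 : 0 <= sb s * sc s.
  rewrite -(@pmulr_rge0 _ (sa s ^+ 2)) //.
  by rewrite [X in 0 <= X](_ : _ = (sa s * sb s) * (sa s * sc s)); [exact: mulr_ge0 | ring].
(* In a polar strip b c = u v sh(u v)^2, so this fixes p = u v; the entries a, b, c and [sbc] then
   give e, v, u and v4 by division. *)
have [p p0 pE] := sh_surj q0.
have c0 := ch_gt0 p0; have s0 := sh_gt0 p0.
have cn : ch p != 0 by rewrite gt_eqF.
have sn : sh p != 0 by rewrite gt_eqF.
pose e := sa s / ch p; pose u := sc s * e / sh p; pose v := sb s / (e * sh p).
pose v4 := sbc s / (e * sh p).
have en : e != 0 by rewrite mulf_neq0 ?invr_eq0.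
have uvp : u * v = p.
  transitivity (sb s * sc s / sh p ^+ 2); first by rewrite /u /v; field; rewrite en sn.
  by rewrite -pE; field.
have uE : u = sa s * sc s / (ch p * sh p) by rewrite /u /e; field; rewrite sn cn.
have vE : v = sa s * sb s * (ch p / (sa s ^+ 2 * sh p)).
  by rewrite /v /e; field; rewrite an sn cn.
have k0 : 0 < ch p / (sa s ^+ 2 * sh p) by rewrite divr_gt0 // mulr_gt0.
have l0 : 0 < ch p * sh p by exact: mulr_gt0.
have cone : cone_strip u v v4.
  split; first by rewrite uE divr_ge0 // ltW.
    by rewrite vE mulr_ge0 // ltW.
  move=> /eqP; rewrite /v mulf_eq0 invr_eq0 mulf_eq0 (negbTE en) (negbTE sn) orbF /= orbF.
  by move=> /eqP /b0; rewrite /v4 => ->; rewrite mul0r.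
pose er := (sar s - a3 * (v4 * u * ch1 p)) / ch p.
exists e, er, u, v, v4; split=> //.
- apply: (strip_eq a3n rs (polar_strip_rel er en a3n cone)) => //=; rewrite uvp.
  + by rewrite /e; field.
  + by rewrite /v; field; rewrite en sn.
  + by rewrite /u; field; rewrite en sn.
  + by rewrite /er; field.
  + by rewrite /v4; field; rewrite en sn.
- by move=> ?; rewrite vE mulr_gt0.
- by move=> ?; rewrite uE divr_gt0.
Qed.

Definition lowmx (e1 e2 e3 e4 e5 : R) : 'M[R]_3 := mx3 e1 0 0 0 e2 0 e4 e5 e3.

Definition G0mx (e1 e2 e3 e4 e5 : R) : 'M[R]_(3 + 3) :=
  block_mx (lowmx e1 e2 e3 e4 e5) 0 0 (invmx (lowmx e1 e2 e3 e4 e5)^T).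

Lemma G0P g : @G0 R g <-> exists e1 e2 e3 e4 e5,
  [/\ e1 != 0, e2 != 0, 0 < e3 & g = G0mx e1 e2 e3 e4 e5].
Proof.
split=> [[A [[a01 a02 a10 a12 a22] an] <-]|[e1 [e2 [e3 [e4 [e5 [n1 n2 e30 ->]]]]]]].
  exists (A 0 0), (A 1 1), (A 2 2), (A 2 0), (A 2 1).
  move: an; rewrite mulf_eq0 negb_or => /andP[-> ->]; split=> //.
  have E : A = lowmx (A 0 0) (A 1 1) (A 2 2) (A 2 0) (A 2 1).
    by rewrite [LHS]mx3_eta a01 a02 a10 a12.
  by rewrite /G0mx -E.
exists (lowmx e1 e2 e3 e4 e5) => //; split; first by split; rewrite mxE.
by rewrite !mxE mulf_neq0.
Qed.

Lemma invmx_lowmxT (e1 e2 e3 e4 e5 : R) : e1 != 0 -> e2 != 0 -> e3 != 0 ->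
  invmx (lowmx e1 e2 e3 e4 e5)^T =
  mx3 e1^-1 0 (- (e4 / (e1 * e3))) 0 e2^-1 (- (e5 / (e2 * e3))) 0 0 e3^-1.
Proof.
move=> n1 n2 n3; set A := _^T; set B := mx3 _ _ _ _ _ _ _ _ _.
have AB : A *m B = 1%:M.
  rewrite /A /B /lowmx mx3T mx3M mx3_scalar.
  congr mx3; try ring; field; by rewrite ?n1 ?n2 ?n3.
have uA : A \in unitmx by case: (mulmx1_unit AB).
by rewrite -[RHS](mulKmx uA) AB mulmx1.
Qed.

Lemma G0mx_expmx (e1 e2 e3 e4 e5 u1 u2 v1 v2 v3 v4 v5 : R) :
  e1 != 0 -> e2 != 0 -> e3 != 0 -> 0 <= u1 * v1 -> 0 <= u2 * v2 ->
  G0mx e1 e2 e3 e4 e5 *m expmx (odd_mx u1 u2 v1 v2 v3 v4 v5) =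
  Gmx (polar_strip e1 e4 e3 u1 v1 v4) (polar_strip e2 e5 e3 u2 v2 v5) e3
      (e4 * (v4 * sh (u1 * v1)) + e5 * (v5 * sh (u2 * v2))
       + e3 * (v3 + (v4 ^+ 2 * u1 * sh1 (u1 * v1) + v5 ^+ 2 * u2 * sh1 (u2 * v2))))
      e3^-1.
Proof.
move=> n1 n2 n3 p1 p2; rewrite expmx_odd // /G0mx invmx_lowmxT // /lowmx.
rewrite /Gmx mulmx_block !mul0mx !addr0 !add0r !mx3M.
by congr block_mx; congr mx3 => /=; ring.
Qed.

Definition strips_interior s t (b3 : R) : Prop :=
  [/\ 0 < sa s * sb s /\ 0 < sa s * sc s, 0 < sa t * sb t /\ 0 < sa t * sc t &
      sbr s * sbc s / sb s + sbr t * sbc t / sb t < b3].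

Lemma strips_interior_compress s t b3 : strips_interior s t b3 -> strips_compress s t b3.
Proof.
have half r : 0 < sa r * sb r -> 0 < sa r * sc r -> strip_nonneg r.
  move=> ab ac; split; try exact: ltW.
    by apply/eqP => a0; rewrite a0 mul0r ltxx in ab.
  by move=> b0; rewrite b0 mulr0 ltxx in ab.
by move=> [[? ?] [? ?] /ltW]; split=> //; exact: half.
Qed.

Lemma polar_decomposition s t (a3 b3 d3 : R) : 0 < a3 -> a3 * d3 = 1 ->
  strip_rel a3 s -> strip_rel a3 t -> strips_compress s t b3 ->
  exists h u1 u2 v1 v2 v3 v4 v5, [/\ G0 h,
    Gmx s t a3 b3 d3 = h *m expmx (odd_mx u1 u2 v1 v2 v3 v4 v5),
    [/\ 0 <= u1, 0 <= u2 & psd_coords v1 v2 v3 v4 v5] &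
    strips_interior s t b3 -> [/\ 0 < u1, 0 < u2 & Omega (symx v1 v2 v3 v4 v5)]].
Proof.
move=> a30 ad3 rs rt [ns nt sch].
have a3n : a3 != 0 by rewrite gt_eqF.
have [e1 [e4 [u1 [v1 [v4 [n1 k1 sE vs us]]]]]] := polar_strip_exists a30 rs ns.
have [e2 [e5 [u2 [v2 [v5 [n2 k2 tE vt ut]]]]]] := polar_strip_exists a30 rt nt.
pose S := v4 ^+ 2 * u1 * sh1 (u1 * v1) + v5 ^+ 2 * u2 * sh1 (u2 * v2).
(* The corner entry of [G0mx_expmx], solved for v3. *)
pose v3 := (b3 - e4 * (v4 * sh (u1 * v1)) - e5 * (v5 * sh (u2 * v2))) / a3 - S.
have b3E : b3 = e4 * (v4 * sh (u1 * v1)) + e5 * (v5 * sh (u2 * v2)) + a3 * (v3 + S).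
  by rewrite /v3; field.
have piv : b3 - (sbr s * sbc s / sb s + sbr t * sbc t / sb t) =
    a3 * (v3 - (v4 ^+ 2 / v1 + v5 ^+ 2 / v2)).
  by rewrite sE tE !polar_strip_pivot // b3E /S; ring.
have [u10 v10 v4E] := k1; have [u20 v20 v5E] := k2.
exists (G0mx e1 e2 a3 e4 e5), u1, u2, v1, v2, v3, v4, v5; split.
- by apply/G0P; exists e1, e2, a3, e4, e5.
- rewrite G0mx_expmx ?mulr_ge0 // -sE -tE -b3E.
  by congr Gmx; rewrite -[RHS]mulr1 -ad3 mulKf.
- by split=> //; split=> //; rewrite -subr_ge0 -(pmulr_rge0 _ a30) -piv subr_ge0.
- move=> [[ab ac] [ab' ac'] lt]; split; [exact: us|exact: ut|].
  apply/Omega_symx; split; [exact: vs|exact: vt|].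
  by rewrite -subr_gt0 -(pmulr_rgt0 _ a30) -piv subr_gt0.
Qed.

Lemma polar_product h u1 u2 v1 v2 v3 v4 v5 : G0 h ->
  0 <= u1 -> 0 <= u2 -> psd_coords v1 v2 v3 v4 v5 ->
  exists s t a3 b3 d3, [/\ 0 < a3, a3 * d3 = 1, strip_rel a3 s, strip_rel a3 t &
   [/\ h *m expmx (odd_mx u1 u2 v1 v2 v3 v4 v5) = Gmx s t a3 b3 d3,
    strips_compress s t b3 &
    0 < u1 -> 0 < u2 -> Omega (symx v1 v2 v3 v4 v5) -> strips_interior s t b3]].
Proof.
move=> /G0P[e1 [e2 [e3 [e4 [e5 [n1 n2 e30 ->]]]]]] u10 u20 [[v10 v4E] [v20 v5E] v3E].
have n3 : e3 != 0 by rewrite gt_eqF.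
have k1 : cone_strip u1 v1 v4 by [].
have k2 : cone_strip u2 v2 v5 by [].
rewrite G0mx_expmx ?mulr_ge0 //.
set b3 := _ + e3 * _; set s := polar_strip e1 _ _ _ _ _; set t := polar_strip e2 _ _ _ _ _.
have piv : b3 - (sbr s * sbc s / sb s + sbr t * sbc t / sb t) =
    e3 * (v3 - (v4 ^+ 2 / v1 + v5 ^+ 2 / v2)).
  by rewrite !polar_strip_pivot // /b3; ring.
exists s, t, e3, b3, e3^-1; split; rewrite ?divff //; try exact: polar_strip_rel.
split=> //.
  split; try exact: polar_strip_nonneg.
  by rewrite -subr_ge0 piv pmulr_rge0 // subr_ge0.
move=> u1p u2p /Omega_symx[v1p v2p v3p].
have l1 : 0 < ch (u1 * v1) * sh (u1 * v1) by rewrite ch_sh_gt0 // mulr_ge0.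
have l2 : 0 < ch (u2 * v2) * sh (u2 * v2) by rewrite ch_sh_gt0 // mulr_ge0.
split; last by rewrite -subr_gt0 piv pmulr_rgt0 // subr_gt0.
  rewrite polar_strip_ab polar_strip_ac //; split; last exact: mulr_gt0.
  by apply: mulr_gt0 => //; apply: mulr_gt0 => //; rewrite exprn_even_gt0.
rewrite polar_strip_ab polar_strip_ac //; split; last exact: mulr_gt0.
by apply: mulr_gt0 => //; apply: mulr_gt0 => //; rewrite exprn_even_gt0.
Qed.

End Polar.

(** * Interiors *)

Section Interiors.
Variable R : realType.
Implicit Types (s t : strip R).

(** Translation by a unipotent element 1 + e n with n^2 = 0 is affine in e, so the curves needed
    inside [G] are straight lines and [near_line] applies. *)
Definition strip_line (e : R) s t : strip R :=
  Strip (sa s + e * sa t) (sb s + e * sb t) (sc s + e * sc t) (sd s + e * sd t)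
    (sar s + e * sar t) (sbr s + e * sbr t) (sbc s + e * sbc t) (sdc s + e * sdc t).

Lemma Gmx_line (e : R) s t s' t' (a3 b3 d3 b' : R) :
  Gmx s t a3 b3 d3 + e *: Gmx s' t' 0 b' 0 =
  Gmx (strip_line e s s') (strip_line e t t') a3 (b3 + e * b') d3.
Proof.
rewrite /Gmx scale_block_mx add_block_mx !mx3Z !mx3D.
by rewrite !(mulr0, addr0).
Qed.

Definition strip0 : strip R := Strip 0 0 0 0 0 0 0 0.

Lemma strip_line0 (e : R) s : strip_line e s strip0 = s.
Proof. by case: s => *; rewrite /strip_line /= !(mulr0, addr0). Qed.

(* Derivatives of right translation by the lower and the upper unipotent       *)
(* subgroups of the i-th copy of SL_2.                                          *)
Definition strip_lower s : strip R :=
  Strip (- sb s) 0 (- sd s) 0 (- sbr s) 0 0 0.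

Definition strip_upper s : strip R :=
  Strip 0 (- sa s) 0 (- sc s) 0 (- sar s) 0 0.

Lemma strip_lower_rel (a3 e : R) s : strip_rel a3 s ->
  strip_rel a3 (strip_line e s (strip_lower s)).
Proof.
case: s => a b c d ar br bc dc [/= r1 r2 r3].
by split=> /=; rewrite -?r1 ?mulr0 ?addr0; [ring | lra | lra].
Qed.

Lemma strip_upper_rel (a3 e : R) s : strip_rel a3 s ->
  strip_rel a3 (strip_line e s (strip_upper s)).
Proof.
case: s => a b c d ar br bc dc [/= r1 r2 r3].
by split=> /=; rewrite -?r1 ?mulr0 ?addr0; [ring | lra | lra].
Qed.

(** If c were 0, then a d = 1 and the translated strip would have a c equal to - e (1 - e b d),
    which is negative for such small e. *)
Lemma strip_lower_gt0 (a3 e : R) s : 0 < e -> e * (1 + sb s * sd s) < 1 ->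
  strip_rel a3 s -> strip_nonneg s -> strip_nonneg (strip_line e s (strip_lower s)) ->
  0 < sa s * sc s.
Proof.
case: s => a b c d ar br bc dc /= e0 es [/= r1 _ _] [/= an ab ac _] [/= _ _ ace _].
rewrite lt_neqAle ac andbT eq_sym mulf_neq0 //; apply/eqP => c0.
move: ace r1; rewrite c0 mulr0 subr0 => ace ad.
suff : 0 < e * (1 - e * (b * d)) by move: ace; rewrite -ad; nra.
rewrite mulr_gt0 //; lra.
Qed.

(** If b were 0, the translated strip would have a b equal to - e a^2. *)
Lemma strip_upper_gt0 (e : R) s : 0 < e ->
  strip_nonneg s -> strip_nonneg (strip_line e s (strip_upper s)) ->
  0 < sa s * sb s.
Proof.
case: s => a b c d ar br bc dc /= e0 [/= an ab ac _] [/= _ abe _ _].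
rewrite lt_neqAle ab andbT eq_sym mulf_neq0 //; apply/eqP => b0.
have : 0 < e * a ^+ 2 by rewrite mulr_gt0 // exprn_even_gt0.
move: abe; rewrite b0; lra.
Qed.

Lemma near_gt0 (T : topologicalType) (f : T -> R) (x : T) :
  {for x, continuous f} -> 0 < f x -> \forall y \near x, 0 < f y.
Proof. by move=> cf f0; apply: cvgr_gt f0; exact: cf. Qed.

Lemma near_right_ex (P Q : set R) :
  (\forall e \near (0 : R)^'+, P e) -> (\forall e \near (0 : R)^'+, Q e) ->
  exists e : R, [/\ 0 < e, P e & Q e].
Proof.
move=> nP nQ; have PF := at_right_proper_filter (0 : R).
have nPQ : (0 : R)^'+ ((P `&` Q) `&` (fun e : R => 0 < e)).
  by apply: filterI; [exact: filterI | exact: nbhs_right_gt].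
by have [e [[Pe Qe] e0]] := @filter_ex _ _ PF _ nPQ; exists e.
Qed.

Lemma cts_coord m n (M : 'M[R]_(m, n)) i j :
  {for M, continuous (fun N : 'M[R]_(m, n) => N i j)}.
Proof. exact: coord_continuous. Qed.

Lemma rel_interior_Gamma g : rel_interior (@G R) (@Gamma R) g <->
  exists s t a3 b3 d3, [/\ g = Gmx s t a3 b3 d3, 0 < a3, a3 * d3 = 1,
    strip_rel a3 s & strip_rel a3 t] /\ strips_interior s t b3.
Proof.
split=> [[/GP[s [t [a3 [b3 [d3 [-> a30 ad3 rs rt]]]]]] nb]|].
  exists s, t, a3, b3, d3; split=> //.
  have line s' t' b' : (forall e, strip_rel a3 (strip_line e s s')) ->
      (forall e, strip_rel a3 (strip_line e t t')) ->
      \forall e \near (0 : R)^'+,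
        strips_compress (strip_line e s s') (strip_line e t t') (b3 + e * b').
    move=> rs' rt'; have := near_line (Gmx s' t' 0 b' 0) nb.
    apply: filterS => e; rewrite Gmx_line => /(_ (G_Gmx _ a30 ad3 (rs' e) (rt' e))).
    by move/Gamma_Gmx; apply.
  have rel0 r e : strip_rel a3 r -> strip_rel a3 (strip_line e r strip0).
    by rewrite strip_line0.
  have [ns nt _] : strips_compress s t b3.
    by apply/(Gamma_Gmx _ a30 ad3 rs rt); apply: (nbhs_singleton nb); exact: G_Gmx.
  have small (b : R) : \forall e \near (0 : R)^'+, e * (1 + b) < 1.
    near=> e; have e0 : 0 < e by near: e; exact: nbhs_right_gt.
    have eb : e < (1 + `|b|)^-1.
      by near: e; apply: nbhs_right_lt; rewrite invr_gt0 ltr_pwDl.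
    have b0 : 0 < 1 + `|b| by rewrite ltr_pwDl.
    have : e * (1 + `|b|) < 1 by rewrite -ltr_pdivlMr // div1r.
    apply: le_lt_trans; rewrite ler_pM2l // lerD2l; exact: ler_norm.
  have h1 : 0 < sa s * sc s.
    have [e [e0 [ce _ _] es]] := near_right_ex (line _ _ 0 (fun e => @strip_lower_rel _ e s rs)
      (fun e => rel0 t e rt)) (small (sb s * sd s)).
    exact: strip_lower_gt0 e0 es rs ns ce.
  have h2 : 0 < sa t * sc t.
    have [e [e0 [_ ce _] es]] := near_right_ex (line _ _ 0 (fun e => rel0 s e rs)
      (fun e => @strip_lower_rel _ e t rt)) (small (sb t * sd t)).
    exact: strip_lower_gt0 e0 es rt nt ce.
  have h3 : 0 < sa s * sb s.
    have [e [e0 [ce _ _] es]] := near_right_ex (line _ _ 0 (fun e => @strip_upper_rel _ e s rs)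
      (fun e => rel0 t e rt)) (small (sb s * sd s)).
    exact: strip_upper_gt0 e0 ns ce.
  have h4 : 0 < sa t * sb t.
    have [e [e0 [_ ce _] es]] := near_right_ex (line _ _ 0 (fun e => rel0 s e rs)
      (fun e => @strip_upper_rel _ e t rt)) (small (sb t * sd t)).
    exact: strip_upper_gt0 e0 nt ce.
  (* Lowering b3 alone stays in [G], so the Schur inequality holds with room e. *)
  split=> //; have [e [e0 [_ _ + _]]] := near_right_ex (line _ _ (-1)
    (fun e => rel0 s e rs) (fun e => rel0 t e rt)) (small 0).
  by rewrite !strip_line0; lra.
move=> [s [t [a3 [b3 [d3 [[-> a30 ad3 rs rt] [[h1 h2] [h3 h4] h5]]]]]]].
split; first exact: G_Gmx.
pose A (i j : 'I_3) (g : 'M[R]_(3 + 3)) := g (lshift 3 i) (lshift 3 j).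
pose B (i j : 'I_3) (g : 'M[R]_(3 + 3)) := g (lshift 3 i) (rshift 3 j).
pose U (i j : 'I_3) (g : 'M[R]_(3 + 3)) := g (rshift 3 i) (lshift 3 j).
have cA x i j : {for x, continuous (A i j)} by exact: cts_coord.
have cB x i j : {for x, continuous (B i j)} by exact: cts_coord.
have cU x i j : {for x, continuous (U i j)} by exact: cts_coord.
have AE s' t' a b d i j : A i j (Gmx s' t' a b d) =
    mx3 (sa s') 0 0 0 (sa t') 0 (sar s') (sar t') a i j.
  by rewrite /A /Gmx block_mxEul.
have BE s' t' a b d i j : B i j (Gmx s' t' a b d) =
    mx3 (sb s') 0 (sbc s') 0 (sb t') (sbc t') (sbr s') (sbr t') b i j.
  by rewrite /B /Gmx block_mxEur.
have UE s' t' a b d i j : U i j (Gmx s' t' a b d) =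
    mx3 (sc s') 0 0 0 (sc t') 0 0 0 0 i j.
  by rewrite /U /Gmx block_mxEdl.
set gg := Gmx _ _ _ _ _.
have n1 : \forall y \near gg, 0 < A 0 0 y * B 0 0 y.
  by apply: near_gt0; [exact: continuousM | rewrite AE BE !mxE].
have n2 : \forall y \near gg, 0 < A 0 0 y * U 0 0 y.
  by apply: near_gt0; [exact: continuousM | rewrite AE UE !mxE].
have n3 : \forall y \near gg, 0 < A 1 1 y * B 1 1 y.
  by apply: near_gt0; [exact: continuousM | rewrite AE BE !mxE].
have n4 : \forall y \near gg, 0 < A 1 1 y * U 1 1 y.
  by apply: near_gt0; [exact: continuousM | rewrite AE UE !mxE].
have b1n : sb s != 0 by apply/eqP => b0; rewrite b0 mulr0 ltxx in h1.
have b2n : sb t != 0 by apply/eqP => b0; rewrite b0 mulr0 ltxx in h3.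
(* The Schur complement is continuous here because neither [sb s] nor [sb t] vanishes. *)
have n5 : \forall y \near gg, 0 < B 2 2 y
    - (B 2 0 y * B 0 2 y * (B 0 0 y)^-1 + B 2 1 y * B 1 2 y * (B 1 1 y)^-1).
  apply: near_gt0; last by rewrite !BE !mxE /= subr_gt0.
  apply: continuousB; first exact: cB.
  by apply: continuousD; apply: continuousM;
    [exact: continuousM | apply: continuousV => //; rewrite BE mxE
    |exact: continuousM | apply: continuousV => //; rewrite BE mxE].
apply: filterS (filterI (filterI (filterI n1 n2) (filterI n3 n4)) n5).
move=> y [[[k1 k2] [k3 k4]] k5] /GP[s' [t' [a3' [b3' [d3' [yE a30' ad3' rs' rt']]]]]].
move: k1 k2 k3 k4 k5; rewrite yE !AE !BE !UE !mxE /= => k1 k2 k3 k4; rewrite subr_gt0 => k5.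
by apply/Gamma_Gmx => //; exact: strips_interior_compress.
Unshelve. all: by end_near. Qed.

Lemma g_oddP X : @g_odd R X <-> exists u1 u2 v1 v2 v3 v4 v5, X = odd_mx u1 u2 v1 v2 v3 v4 v5.
Proof.
split=> [[_ [u [/is_diag_mxP du u2] <-] [_ [v /VE vE <-] <-]]|].
  exists (u 0 0), (u 1 1), (v 0 0), (v 1 1), (v 2 2), (v 2 0), (v 2 1).
  rewrite add_block_mx !addr0 !add0r /odd_mx -vE; congr block_mx.
  by rewrite [LHS]mx3_eta u2 (du 0 1) ?(du 0 2) ?(du 1 0) ?(du 1 2) ?(du 2 0) ?(du 2 1).
move=> [u1 [u2 [v1 [v2 [v3 [v4 [v5 ->]]]]]]].
exists (block_mx 0 0 (mx3 u1 0 0 0 u2 0 0 0 0) 0).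
  exists (mx3 u1 0 0 0 u2 0 0 0 0) => //; split; last by rewrite mxE.
  by apply/is_diag_mxP; case=> [[|[|[|//]]] ?] [[|[|[|//]]] ?] //; rewrite mxE.
exists (block_mx 0 (symx v1 v2 v3 v4 v5) 0 0).
  by exists (symx v1 v2 v3 v4 v5) => //; exact: V_symx.
by rewrite add_block_mx !addr0 !add0r.
Qed.

Lemma C_odd_mx u1 u2 v1 v2 v3 v4 v5 : @C R (odd_mx u1 u2 v1 v2 v3 v4 v5) <->
  [/\ 0 <= u1, 0 <= u2 & psd_coords v1 v2 v3 v4 v5].
Proof.
have uE : mx3 u1 0 0 0 u2 0 0 0 0 = symx u1 u2 0 0 0 by [].
split=> [[v clv [u [clu _] /eq_block_mx[_ vE uE' _]]]|[u10 u20 P]].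
  move: clv clu; rewrite vE uE' uE => /Omega_cl_symx P /Omega_cl_symx[[? _] [? _] _].
  by split.
exists (symx v1 v2 v3 v4 v5); first exact/Omega_cl_symx.
exists (mx3 u1 0 0 0 u2 0 0 0 0) => //; split.
  rewrite uE; apply/Omega_cl_symx; split=> //.
  by rewrite expr0n /= !mul0r addr0.
split; last by rewrite mxE.
by apply/is_diag_mxP; case=> [[|[|[|//]]] ?] [[|[|[|//]]] ?] //; rewrite mxE.
Qed.

Lemma C_g_odd X : @C R X -> exists u1 u2 v1 v2 v3 v4 v5, X = odd_mx u1 u2 v1 v2 v3 v4 v5.
Proof.
move=> [v [Vv _] [u [_ V'u] <-]]; apply/g_oddP.
exists (block_mx 0 0 u 0); first by exists u.
exists (block_mx 0 v 0 0); first by exists v.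
by rewrite add_block_mx !addr0 !add0r.
Qed.

Lemma C_intP X : @C_int R X <-> exists u1 u2 v1 v2 v3 v4 v5,
  [/\ X = odd_mx u1 u2 v1 v2 v3 v4 v5, 0 < u1, 0 < u2 & Omega (symx v1 v2 v3 v4 v5)].
Proof.
split=> [[/g_oddP[u1 [u2 [v1 [v2 [v3 [v4 [v5 ->]]]]]]] nb]|].
  exists u1, u2, v1, v2, v3, v4, v5.
  (* Subtracting e from the diagonals of u and v stays in [C] for small e; adding it back by
     [psd_coords_Omega] gives strict positivity. *)
  have line : \forall e \near (0 : R)^'+, [/\ 0 <= u1 - e, 0 <= u2 - e &
      psd_coords (v1 - e) (v2 - e) (v3 - e) v4 v5].
    have := near_line (odd_mx (-1) (-1) (-1) (-1) (-1) 0 0) nb.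
    apply: filterS => e.
    rewrite /odd_mx /symx scale_block_mx add_block_mx !mx3Z !mx3D.
    rewrite !(scaler0, mulr0, mulrN1, addr0) => Ce.
    by apply/C_odd_mx; apply: Ce; apply/g_oddP; do 7 eexists.
  have [e [e0 [u1e u2e P] _]] := near_right_ex line line.
  split=> //; [lra | lra |].
  by have := psd_coords_Omega e0 P; rewrite !subrK.
move=> [u1 [u2 [v1 [v2 [v3 [v4 [v5 [-> u10 u20 /Omega_symx[v10 v20 v30]]]]]]]]].
split; first by apply/g_oddP; do 7 eexists.
pose B (i j : 'I_3) (g : 'M[R]_(3 + 3)) := g (lshift 3 i) (rshift 3 j).
pose U (i j : 'I_3) (g : 'M[R]_(3 + 3)) := g (rshift 3 i) (lshift 3 j).
have cB x i j : {for x, continuous (B i j)} by exact: cts_coord.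
have cU x i j : {for x, continuous (U i j)} by exact: cts_coord.
have BE p q x1 x2 x3 x4 x5 i j : B i j (odd_mx p q x1 x2 x3 x4 x5) =
    symx x1 x2 x3 x4 x5 i j by rewrite /B /odd_mx block_mxEur.
have UE p q x1 x2 x3 x4 x5 i j : U i j (odd_mx p q x1 x2 x3 x4 x5) =
    mx3 p 0 0 0 q 0 0 0 0 i j by rewrite /U /odd_mx block_mxEdl.
set X0 := odd_mx _ _ _ _ _ _ _.
have n1 : \forall y \near X0, 0 < U 0 0 y.
  by apply: near_gt0; [exact: cU | rewrite UE mxE].
have n2 : \forall y \near X0, 0 < U 1 1 y.
  by apply: near_gt0; [exact: cU | rewrite UE mxE].
have n3 : \forall y \near X0, 0 < B 0 0 y.
  by apply: near_gt0; [exact: cB | rewrite BE mxE].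
have n4 : \forall y \near X0, 0 < B 1 1 y.
  by apply: near_gt0; [exact: cB | rewrite BE mxE].
have n5 : \forall y \near X0, 0 < B 2 2 y
    - (B 2 0 y * B 2 0 y * (B 0 0 y)^-1 + B 2 1 y * B 2 1 y * (B 1 1 y)^-1).
  apply: near_gt0; last by rewrite !BE !mxE /= subr_gt0 -!expr2.
  apply: continuousB; first exact: cB.
  by apply: continuousD; apply: continuousM;
    [exact: continuousM | apply: continuousV => //; rewrite BE mxE gt_eqF
    |exact: continuousM | apply: continuousV => //; rewrite BE mxE gt_eqF].
apply: filterS (filterI (filterI (filterI n1 n2) (filterI n3 n4)) n5).
move=> y [[[k1 k2] [k3 k4]] k5] /g_oddP[u1' [u2' [v1' [v2' [v3' [v4' [v5' yE]]]]]]].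
move: k1 k2 k3 k4 k5; rewrite yE !BE !UE !mxE /= -!expr2 => k1 k2 k3 k4; rewrite subr_gt0 => k5.
apply/C_odd_mx; split; [exact: ltW | exact: ltW |].
by split; [split; [exact: ltW | move=> v0; rewrite v0 ltxx in k3]
          |split; [exact: ltW | move=> v0; rewrite v0 ltxx in k4] | exact: ltW].
Qed.

End Interiors.

Theorem theorem4p1 (R : realType) :
  @Gamma R = [set g *m expmx X | g in @G0 R & X in @C R] /\
  rel_interior (@G R) (@Gamma R)
    = [set g *m expmx X | g in @G0 R & X in @C_int R].
Proof.
split; apply/seteqP; split=> g /=.
- move=> Gg; have [s [t [a3 [b3 [d3 [gE a30 ad3 rs rt]]]]]] := GP Gg.1.
  move: Gg; rewrite gE => /(Gamma_Gmx _ a30 ad3 rs rt) sc.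
  have [h [u1 [u2 [v1 [v2 [v3 [v4 [v5 [G0h -> P _]]]]]]]]] :=
    polar_decomposition a30 ad3 rs rt sc.
  exists h => //; exists (odd_mx u1 u2 v1 v2 v3 v4 v5) => //; exact/C_odd_mx.
- move=> [h G0h [X CX <-]].
  have [u1 [u2 [v1 [v2 [v3 [v4 [v5 XE]]]]]]] := C_g_odd CX.
  move: CX; rewrite XE => /C_odd_mx[u10 u20 P].
  have [s [t [a3 [b3 [d3 [a30 ad3 rs rt [-> sc _]]]]]]] := polar_product G0h u10 u20 P.
  exact/Gamma_Gmx.
- move=> /rel_interior_Gamma[s [t [a3 [b3 [d3 [[-> a30 ad3 rs rt] si]]]]]].
  have [h [u1 [u2 [v1 [v2 [v3 [v4 [v5 [G0h -> _ /(_ si)[u10 u20 Ov]]]]]]]]]] :=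
    polar_decomposition a30 ad3 rs rt (strips_interior_compress si).
  exists h => //; exists (odd_mx u1 u2 v1 v2 v3 v4 v5) => //.
  by apply/C_intP; exists u1, u2, v1, v2, v3, v4, v5.
- move=> [h G0h [X /C_intP[u1 [u2 [v1 [v2 [v3 [v4 [v5 [-> u10 u20 Ov]]]]]]]] <-]].
  have P : psd_coords v1 v2 v3 v4 v5.
    have /Omega_symx[v10 v20 v30] := Ov.
    by split; [split; [exact: ltW | move=> v0; rewrite v0 ltxx in v10]
              |split; [exact: ltW | move=> v0; rewrite v0 ltxx in v20] | exact: ltW].
  have [s [t [a3 [b3 [d3 [a30 ad3 rs rt [-> _ si]]]]]]] :=
    polar_product G0h (ltW u10) (ltW u20) P.
  apply/rel_interior_Gamma; exists s, t, a3, b3, d3; split=> //; exact: si.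
Qed.
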